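(* Define $\alpha:\mathrm{Herm}_\varepsilon^\circ(n)\to W^\varepsilon(D,J)$ by $\alpha\langle t\rangle=[t]$. Then for all nonsingular $\varepsilon$-hermitian matrices $r,s,t\in D^{n\times n}$: (i) $r+s=0$ implies $\alpha\langle r\rangle+\alpha\langle s\rangle=0$; (ii) $r+s+t=0$ implies $\alpha\langle r\rangle+\alpha\langle s\rangle+\alpha\langle t\rangle+\alpha\langle -r^{-J}-s^{-J}\rangle=0$. Therefore $$\mathsf m:\langle X,Y,Z\rangle\longmapsto[\kappa(X,Y,Z)]$$ defines a $W^\varepsilon(D,J)$-valued $\mathbf U(M)$-invariant $2$-cocycle on the alternating chain complex $\tilde C_2(Fl(\Gamma))$ of the flag complex of the opposition graph $\Gamma$ of $M$.
   Context: $D$ is a field or division ring of arbitrary characteristic with an involution $J$ (an antiautomorphism with $J^2=\mathrm{id}$; $J=\mathrm{id}$ is allowed if $D$ is commutative), and $\varepsilon\in\{1,-1\}$. Modules are finite dimensional right $D$-modules. For a matrix $a$ over $D$, $a^J$ denotes the transpose of $a$ with $J$ applied to all entries, and $a^{-J}=(a^J)^{-1}$. For $\delta=\pm1$, a $\delta$-hermitian form on $M$ is a biadditive map $h:M\times M\to D$ with $h(ua,vb)=a^Jh(u,v)b$ and $h(u,v)=h(v,u)^J\delta$. For a right $D$-module $X$, $X^J$ is its dual space made into a right $D$-module by $(\xi a)(v)=a^J\xi(v)$. The hyperbolic $\delta$-hermitian module on $X$ is $X\oplus X^J$ with the form $h_X((x,\xi),(y,\eta))=\xi(y)+\eta(x)^J\delta$;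 every isometric module is also called hyperbolic, and its rank is $\dim X$. $M$ is a $-\varepsilon$-hermitian hyperbolic module of rank $n$ with form $h$, and $\mathbf U(M)$ is its isometry group. A Lagrangian is a subspace $X\subseteq M$ with $X=X^\perp$. Two Lagrangians $X,Y$ are opposite if $X\cap Y=0$ (equivalently $M=X+Y$). A matrix $t\in D^{n\times n}$ is $\varepsilon$-hermitian if $t=t^J\varepsilon$. $\mathrm{Herm}_\varepsilon^\circ(n)$ is the set of isomorphism classes $\langle t\rangle=\{a^{-J}ta^{-1}\mid a\in\mathbf{GL}_nD\}$ of nonsingular $\varepsilon$-hermitian $n\times n$ matrices $t$. The invariant $\kappa$: if $X,Y,Z$ are pairwise opposite Lagrangians, choose a basis $x_1,\dots,x_n$ of $X$ and let $y_1,\dots,y_n$ be the basis of $Y$ with $h(y_\mu,x_\nu)=\delta_{\mu\nu}$; then $Z$ has a unique basis of the form $y_\nu+\sum_\mu x_\mu t_{\mu\nu}$, where $t=(t_{\mu\nu})$ is nonsingular and $\varepsilon$-hermitian, and $\kappa(X,Y,Z)=\langle t\rangle$, which does not depend on the choices. The Grothendieck–Witt group $KU_0^\varepsilon(D,J)$ is the group completion of the monoid (under orthogonal sum) of isomorphism classes of nondegenerate $\varepsilon$-hermitian forms, and the Witt group $W^\varepsilon(D,J)$ is its quotient by the subgroup generated by the $\varepsilon$-hermitian hyperbolic modules. $[t]$ denotes the image of $\langle t\rangle$ in $W^\varepsilon(D,J)$. The opposition graph $\Gamma$ of $M$ has the Lagrangians as vertices and the unordered pairs of opposite Lagrangians as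 edges. $Fl(\Gamma)$ is the simplicial set whose $k$-simplices are tuples $(x_0,\dots,x_k)$ of vertices that are pairwise equal or adjacent. The alternating chain complex $\tilde C_*(Fl(\Gamma))$ is the quotient of the free $\mathbb Z$-chain complex on these simplices (usual boundary) by the submodule generated by the $(x_0,\dots,x_k)$ with $x_\mu=x_\nu$ for some $\mu<\nu$ and by all $(x_0,\dots,x_k)-\mathrm{sign}(\pi)(x_{\pi_0},\dots,x_{\pi_k})$, $\pi\in Sym(k+1)$; the coset of $(x_0,\dots,x_k)$ is denoted $\langle x_0,\dots,x_k\rangle$. *)

(* Defs.v *)
From HB Require Import structures.
From mathcomp Require Import all_boot all_order perm all_algebra.
From mathcomp Require Import boolp classical_sets functions.
From mathcomp Require Import freeg.

Set Implicit Arguments.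
Unset Strict Implicit.
Unset Printing Implicit Defensive.

Import GRing.Theory.
Local Open Scope ring_scope.
Local Open Scope classical_set_scope.
Local Open Scope quotient_scope.

Section GeneratedSubgroup.
Variables (V : zmodType) (S : set V).

Definition subgroup_gen : V -> bool :=
  fun x => `[< forall P : {pred V},
    zmod_closed P -> (forall y, S y -> y \in P) -> x \in P >].

Lemma subgroup_gen_closed : zmod_closed subgroup_gen.
Proof.
split=> [|x y].
  by apply/asboolP => P [].
move=> /asboolP xS /asboolP yS; apply/asboolP => P Pc PS.
exact: Pc.2 (xS P Pc PS) (yS P Pc PS).
Qed.

HB.instance Definition _ := GRing.isZmodClosed.Build V subgroup_gen
  subgroup_gen_closed.

Lemma mem_subgroup_gen x : S x -> x \in subgroup_gen.
Proof. by move=> Sx; apply/asboolP => P _; apply. Qed.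

Lemma subgroup_gen_min (P : {pred V}) :
  zmod_closed P -> (forall y, S y -> y \in P) ->
  forall x, x \in subgroup_gen -> x \in P.
Proof. by move=> Pc PS x /asboolP; apply. Qed.

Definition subgroup_gen_zmod : zmodClosed V :=
  GRing.ZmodClosed.clone V subgroup_gen _.

Definition quot_gen : zmodType := Quotient.quot subgroup_gen_zmod.

Definition quot_class (x : V) : quot_gen := \pi_(Quotient.quot subgroup_gen_zmod) x.

Lemma quot_class_is_zmod_morphism : zmod_morphism quot_class.
Proof. by move=> x y; rewrite /quot_class raddfB. Qed.

HB.instance Definition _ := GRing.isZmodMorphism.Build V quot_gen quot_class
  quot_class_is_zmod_morphism.

Lemma quot_classP x y :
  (x - y \in subgroup_gen) = (quot_class x == quot_class y).
Proof. by rewrite Quotient.idealrBE. Qed.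

Definition quot_repr (c : quot_gen) : V :=
  repr (c : Quotient.quot subgroup_gen_zmod).

Lemma quot_reprK : cancel quot_repr quot_class.
Proof. by move=> c; rewrite /quot_class /quot_repr reprK. Qed.

End GeneratedSubgroup.

(* The group completion of a commutative monoid (S, op), as the free abelian
   group on S modulo the relations [op c d] = [c] + [d]. *)
Definition group_completion (S : choiceType) (op : S -> S -> S) : zmodType :=
  quot_gen [set (<< op p.1 p.2 >> - << p.1 >> - << p.2 >> : {freeg S})
           | p in [set: S * S]].

Definition completion_class (S : choiceType) (op : S -> S -> S) (c : S) :
  group_completion op := quot_class _ << c >>.

Record involution (D : nzRingType) := Involution {
  inv_fun :> D -> D;
  inv_add : {morph inv_fun : x y / x + y};
  inv_mul : {morph inv_fun : x y / x * y >-> y * x};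
  inv_invol : involutive inv_fun }.

Section MatrixForms.
Variables (D : nzRingType) (J : involution D).

Lemma inv0 : J 0 = 0.
Proof. by apply: (addrI (J 0)); rewrite -inv_add !addr0. Qed.

Lemma inv1 : J 1 = 1.
Proof. by rewrite -[J 1]mulr1 -{2}[1](inv_invol J) -inv_mul mulr1 inv_invol. Qed.

Lemma inv_sum I (r : seq I) (P : pred I) (F : I -> D) :
  J (\sum_(i <- r | P i) F i) = \sum_(i <- r | P i) J (F i).
Proof. exact: (big_morph J (inv_add J) inv0). Qed.

Definition jtr m n (a : 'M[D]_(m, n)) : 'M[D]_(n, m) := map_mx J a^T.

Lemma jtrK m n : cancel (@jtr m n) (@jtr n m).
Proof. by move=> a; apply/matrixP => i j; rewrite !mxE inv_invol. Qed.

Lemma jtr_mul m n p (a : 'M[D]_(m, n)) (b : 'M[D]_(n, p)) :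
  jtr (a *m b) = jtr b *m jtr a.
Proof.
apply/matrixP => i j; rewrite !mxE inv_sum; apply: eq_bigr => k _.
by rewrite !mxE inv_mul.
Qed.

Lemma jtr1 n : jtr (1%:M : 'M[D]_n) = 1%:M.
Proof.
apply/matrixP => i j; rewrite !mxE eq_sym.
by case: eqP; rewrite ?inv1 ?inv0.
Qed.

(* [unitmx] and [invmx] need a commutative ring *)
Definition is_inverse n (a b : 'M[D]_n) := a *m b = 1%:M /\ b *m a = 1%:M.

Definition nonsingular n (a : 'M[D]_n) := exists b, is_inverse a b.

Definition minv n (a : 'M[D]_n) : 'M[D]_n := xget a [set b | is_inverse a b].

Lemma minvP n (a : 'M[D]_n) : nonsingular a -> is_inverse a (minv a).
Proof. exact: xgetPex. Qed.

Lemma minv_eq n (a b : 'M[D]_n) : is_inverse a b -> minv a = b.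
Proof.
move=> ab; have [_ ca] := minvP (ex_intro _ b ab).
by rewrite -[minv a]mulmx1 -ab.1 mulmxA ca mul1mx.
Qed.

Lemma is_inverse_mul n (a b c d : 'M[D]_n) :
  is_inverse a b -> is_inverse c d -> is_inverse (a *m c) (d *m b).
Proof.
move=> [ab ba] [cd dc]; split.
  by rewrite mulmxA -[a *m c *m d]mulmxA cd mulmx1.
by rewrite mulmxA -[d *m b *m a]mulmxA ba mulmx1.
Qed.

Lemma is_inverse_jtr n (a b : 'M[D]_n) :
  is_inverse a b -> is_inverse (jtr a) (jtr b).
Proof. by move=> [ab ba]; split; rewrite -jtr_mul ?ab ?ba jtr1. Qed.

Definition isoclass n (t : 'M[D]_n) : set 'M[D]_n :=
  [set minv (jtr a) *m t *m minv a | a in [set a | nonsingular a]].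

(* the condition of membership in [isoclass t] without inverses *)
Lemma isoclassP n (t s : 'M[D]_n) :
  isoclass t s <-> exists2 b, nonsingular b & s = jtr b *m t *m b.
Proof.
split=> [[a [b ab] <-]|[b [a ba] ->]].
  rewrite (minv_eq ab) (minv_eq (is_inverse_jtr ab)).
  by exists b => //; exists a; case: ab.
have ab : is_inverse a b by case: ba.
exists a; first by exists b.
by rewrite (minv_eq ab) (minv_eq (is_inverse_jtr ab)).
Qed.

Lemma isoclass_refl n (t : 'M[D]_n) : isoclass t t.
Proof.
apply/isoclassP; exists 1%:M; last by rewrite jtr1 mul1mx mulmx1.
by exists 1%:M; split; rewrite mulmx1.
Qed.

Lemma isoclass_eq n (t s : 'M[D]_n) : isoclass t s -> isoclass s = isoclass t.
Proof.
move=> /isoclassP[b [b' bb'] ->]; apply/seteqP; split=> u /isoclassP[c [c' cc'] ->].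
  apply/isoclassP; exists (b *m c); last by rewrite jtr_mul !mulmxA.
  by exists (c' *m b'); apply: is_inverse_mul.
apply/isoclassP; exists (b' *m c).
  exists (c' *m b); apply: is_inverse_mul => //; split; [exact: bb'.2|exact: bb'.1].
rewrite jtr_mul !mulmxA -[_ *m jtr b' *m jtr b]mulmxA -jtr_mul bb'.1 jtr1 mulmx1.
by rewrite -[_ *m b *m b']mulmxA bb'.1 mulmx1.
Qed.

Variable eps : D.

Definition is_hermitian n (t : 'M[D]_n) := t = jtr t *m eps%:M.

Record nsherm n := NsHerm {
  nsherm_mx :> 'M[D]_n;
  nsherm_nonsingular : nonsingular nsherm_mx;
  nsherm_hermitian : is_hermitian nsherm_mx }.

Definition Herm n : set (set 'M[D]_n) :=
  [set isoclass (nsherm_mx t) | t in [set: nsherm n]].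
Arguments Herm n : clear implicits.

Lemma Herm_isoclass n (t : nsherm n) : isoclass t \in Herm n.
Proof. by apply/mem_set; exists t. Qed.

Definition Herm_class n (t : nsherm n) : Herm n := SigSub (Herm_isoclass t).

Lemma Herm_rep n (c : Herm n) : {t : nsherm n | c = Herm_class t}.
Proof.
apply/cid; have [t _ tc] := set_valP c.
by exists t; apply/val_inj.
Qed.

Lemma Herm_class_eq n (s t : nsherm n) :
  Herm_class s = Herm_class t <-> isoclass t s.
Proof.
split=> [/(congr1 val)/= <-|/isoclass_eq e]; first exact: isoclass_refl.
exact/val_inj.
Qed.

Definition osum_mx m n (r : 'M[D]_m) (s : 'M[D]_n) : 'M[D]_(m + n) :=
  block_mx r 0 0 s.

Lemma osum_mul m n (a b : 'M[D]_m) (c d : 'M[D]_n) :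
  osum_mx a c *m osum_mx b d = osum_mx (a *m b) (c *m d).
Proof.
by rewrite /osum_mx mulmx_block !mulmx0 !mul0mx !addr0 !add0r.
Qed.

Lemma osum_jtr m n (a : 'M[D]_m) (c : 'M[D]_n) :
  jtr (osum_mx a c) = osum_mx (jtr a) (jtr c).
Proof.
rewrite /osum_mx /jtr tr_block_mx map_block_mx !trmx0.
by congr block_mx; apply/matrixP => i j; rewrite !mxE inv0.
Qed.

Lemma osum_scalar m n (e : D) :
  osum_mx (e%:M : 'M_m) (e%:M : 'M_n) = e%:M.
Proof. by rewrite /osum_mx scalar_mx_block. Qed.

Lemma osum_nonsingular m n (a : 'M[D]_m) (c : 'M[D]_n) :
  nonsingular a -> nonsingular c -> nonsingular (osum_mx a c).
Proof.
move=> [b [ab ba]] [d [cd dc]]; exists (osum_mx b d).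
by split; rewrite osum_mul ?ab ?cd ?ba ?dc osum_scalar.
Qed.

Lemma osum_hermitian m n (a : 'M[D]_m) (c : 'M[D]_n) :
  is_hermitian a -> is_hermitian c -> is_hermitian (osum_mx a c).
Proof.
by rewrite /is_hermitian -osum_scalar osum_jtr osum_mul => <- <-.
Qed.

Definition osum m n (r : nsherm m) (s : nsherm n) : nsherm (m + n) :=
  NsHerm (osum_nonsingular (nsherm_nonsingular r) (nsherm_nonsingular s))
         (osum_hermitian (nsherm_hermitian r) (nsherm_hermitian s)).

(* Isomorphism classes of nondegenerate hermitian forms.  A finite
   dimensional module of dimension n is D^n up to isomorphism, on which t is
   the form (u, v) |-> u^J t v; so these classes are the disjoint union of the
   sets [Herm n]. *)
Definition isoclasses : choiceType := {n : nat & Herm n}.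

Definition isocls n (c : Herm n) : isoclasses :=
  existT (fun n => set_type (Herm n)) n c.

Definition isosum (c d : isoclasses) : isoclasses :=
  isocls (Herm_class (osum (sval (Herm_rep (projT2 c)))
                           (sval (Herm_rep (projT2 d))))).

Lemma isosum_class m n (r : nsherm m) (s : nsherm n) :
  isosum (isocls (Herm_class r)) (isocls (Herm_class s))
  = isocls (Herm_class (osum r s)).
Proof.
rewrite /isosum /=; congr isocls; apply/Herm_class_eq.
case: Herm_rep => r' /= /esym/Herm_class_eq/isoclassP[b [b' bb'] ->].
case: Herm_rep => s' /= /esym/Herm_class_eq/isoclassP[d [d' dd'] ->].
apply/isoclassP; exists (osum_mx b d); last by rewrite osum_jtr !osum_mul.
by apply: osum_nonsingular; [exists b'|exists d'].
Qed.

Definition GrothendieckWitt : zmodType := group_completion isosum.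

End MatrixForms.

Arguments Herm {D} J eps n.

(* A right D-module is a left module over the converse ring D^c. *)
Definition rscale (D : nzRingType) (V : lmodType D^c) (v : V) (a : D) : V :=
  (a : D^c) *: v.
Notation "v *:> a" := (rscale v a) (at level 40, left associativity).

Section RightModules.
Variables (D : nzRingType) (J : involution D).

Section Dual.
Variable X : lmodType D^c.

Definition rlinear : (X -> D) -> bool := fun xi =>
  `[< {morph xi : u v / u + v} /\ forall u a, xi (u *:> a) = xi u * a >].

Lemma rlinear_zmod_closed : zmod_closed rlinear.
Proof.
split=> [|f g /asboolP[fD fZ] /asboolP[gD gZ]]; apply/asboolP.
  by split=> [u v|u a]; rewrite /= ?addr0 ?mul0r.
split=> [u v|u a]; rewrite !fctE ?fD ?gD ?fZ ?gZ.
  by rewrite opprD addrACA.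
by rewrite mulrBl.
Qed.

HB.instance Definition _ := GRing.isZmodClosed.Build (X -> D) rlinear
  rlinear_zmod_closed.

Definition jdual of involution D := {xi : X -> D | xi \in rlinear}.

HB.instance Definition _ := SubType.on (jdual J).
HB.instance Definition _ := Choice.on (jdual J).
HB.instance Definition _ := [SubChoice_isSubZmodule of jdual J by <:].

Definition jdual_fun (xi : jdual J) : X -> D := val xi.
Coercion jdual_fun : jdual >-> Funclass.

Lemma jdual_scale_subproof (a : D^c) (xi : jdual J) :
  (fun v => J a * xi v) \in rlinear.
Proof.
have /asboolP[xiD xiZ] := valP xi; apply/asboolP.
by split=> [u v|u b]; rewrite /jdual_fun ?xiD ?xiZ ?mulrDr ?mulrA.
Qed.

Definition jdual_scale (a : D^c) (xi : jdual J) : jdual J :=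
  SigSub (jdual_scale_subproof a xi).

Lemma jdual_scaleA (a b : D^c) xi :
  jdual_scale a (jdual_scale b xi) = jdual_scale (a * b) xi.
Proof.
apply/val_inj/funext => v /=; rewrite /jdual_fun /= mulrA -inv_mul.
by [].
Qed.

Lemma jdual_scale1 : left_id 1 jdual_scale.
Proof. by move=> xi; apply/val_inj/funext => v /=; rewrite inv1 mul1r. Qed.

Lemma jdual_scaleDr : right_distributive jdual_scale +%R.
Proof.
move=> a xi eta; apply/val_inj/funext => v /=.
by rewrite -mulrDr.
Qed.

Lemma jdual_scaleDl xi : {morph jdual_scale^~ xi : a b / a + b}.
Proof.
move=> a b; apply/val_inj/funext => v /=.
by rewrite !fctE inv_add mulrDl.
Qed.

HB.instance Definition _ := GRing.Zmodule_isLmodule.Build D^c (jdual J)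
  jdual_scaleA jdual_scale1 jdual_scaleDr jdual_scaleDl.

End Dual.

Definition hyp_form (delta : D) (X : lmodType D^c)
    (u v : X * jdual X J) : D :=
  u.2 v.1 + J (v.2 u.1) * delta.

Definition is_hyperbolic (delta : D) (n : nat) (M : lmodType D^c)
    (h : M -> M -> D) : Prop :=
  exists X : vectType D^c, dim X = n /\
  exists2 phi : {linear M -> (X * jdual X J)%type},
    bijective phi & forall u v, h u v = hyp_form delta (phi u) (phi v).

Definition mx_form n (t : 'M[D]_n) (u v : 'cV[D^c]_n) : D :=
  (jtr J (u : 'cV[D]_n) *m t *m (v : 'cV[D]_n)) 0 0.

Definition is_hyperbolic_class (eps : D) (c : isoclasses J eps) : Prop :=
  exists m, exists2 t, val (projT2 c) t & is_hyperbolic eps m (mx_form t).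

Definition GW_class (eps : D) (c : isoclasses J eps) : GrothendieckWitt J eps :=
  completion_class _ c.

Definition Witt (eps : D) : zmodType :=
  quot_gen [set GW_class c | c in [set c : isoclasses J eps |
                                    is_hyperbolic_class c]].

Definition Witt_class (eps : D) n (c : Herm J eps n) : Witt eps :=
  quot_class _ (GW_class (isocls c)).

Section Lagrangians.
Variables (M : lmodType D^c) (h : M -> M -> D).

Definition perp (X : set M) : set M := [set v | forall u, X u -> h u v = 0].

Definition Lagrangian : set (set M) :=
  [set X | submod_closed (mem X) /\ X = perp X].

Definition opposite (X Y : Lagrangian) : bool :=
  `[< val X `&` val Y = [set 0] >].

Lemma opposite_sym : symmetric opposite.
Proof. by move=> X Y; rewrite /opposite setIC. Qed.

Definition is_basis (U : set M) n (e : 'I_n -> M) : Prop :=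
  (forall i, U (e i)) /\
  forall v, U v -> exists! c : 'I_n -> D, v = \sum_i e i *:> c i.

(* The set of all matrices obtained from all choices of the basis x of X;
   this set is the class <t> of any of them. *)
Definition kappa n (X Y Z : Lagrangian) : set 'M[D]_n :=
  [set t | exists x y : 'I_n -> M,
    [/\ is_basis (val X) x, is_basis (val Y) y,
        forall mu nu, h (y mu) (x nu) = (mu == nu)%:R
      & is_basis (val Z) (fun nu => y nu + \sum_mu x mu *:> t mu nu)]].

Record isometry := Isometry {
  isometry_fun :> {linear M -> M};
  isometry_bij : bijective isometry_fun;
  isometry_form : forall u v, h (isometry_fun u) (isometry_fun v) = h u v }.

Lemma isometry_Lagrangian (g : isometry) (X : Lagrangian) :
  Lagrangian (g @` val X).
Proof.
have [k gK kK] := isometry_bij g.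
have [[X0 Xl] XX] := set_valP X; split.
  split=> [|a _ _ /set_mem[u Xu <-] /set_mem[v Xv <-]].
    by apply: mem_set; exists 0; [exact: set_mem X0 | rewrite raddf0].
  apply: mem_set; exists (a *: u + v); last by rewrite linearP.
  by apply: set_mem (Xl a u v _ _); apply: mem_set.
apply/seteqP; split=> [_ [v Xv <-] _ [u Xu <-]|v gXv].
  by rewrite isometry_form; move: Xv; rewrite {1}XX; apply.
exists (k v) => //; rewrite XX => u Xu.
by rewrite -(isometry_form g) kK; apply: gXv; exists u.
Qed.

Definition isometry_act (g : isometry) (X : Lagrangian) : Lagrangian :=
  SigSub (mem_set (isometry_Lagrangian g X)).

Lemma isometry_opposite (g : isometry) :
  {mono isometry_act g : X Y / opposite X Y}.
Proof.
have [k gK kK] := isometry_bij g; have g0 : g 0 = 0 := raddf0 _.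
move=> X Y; apply/asboolP/asboolP => /= XY; apply/seteqP; split=> v.
- move=> [Xv Yv]; have : [set 0] (g v).
    by rewrite -XY; split; exists v.
  by rewrite -{1}g0 => /(can_inj gK).
- move=> ->; have : [set 0] (g 0) by rewrite /= g0.
  rewrite -XY => -[[u Xu /(can_inj gK) u0] [w Yw /(can_inj gK) w0]].
  by split; [rewrite -u0|rewrite -w0].
- move=> [[u Xu <-] [w Yw /(can_inj gK) wu]].
  have : [set 0] u by rewrite -XY; split=> //; rewrite -wu.
  by move=> /= ->.
- move=> ->; have [X0 Y0] : (val X `&` val Y) 0 by rewrite XY.
  by split; exists 0.
Qed.

Lemma isometry_homo (g : isometry) :
  {homo isometry_act g : X Y / opposite X Y}.
Proof. by move=> X Y; rewrite isometry_opposite. Qed.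

End Lagrangians.

End RightModules.

Section FlagComplex.
Variables (V : choiceType) (adj : rel V).

Definition is_simplex k (x : {ffun 'I_k.+1 -> V}) : bool :=
  [forall i, forall j, (x i == x j) || adj (x i) (x j)].

Definition Fl k := {x : {ffun 'I_k.+1 -> V} | is_simplex x}.

HB.instance Definition _ k := SubType.on (Fl k).
HB.instance Definition _ k := Choice.on (Fl k).

Definition vertex k (x : Fl k) (i : 'I_k.+1) : V := val x i.

Lemma reindex_subproof k l (f : 'I_l.+1 -> 'I_k.+1) (x : Fl k) :
  is_simplex [ffun i => vertex x (f i)].
Proof.
apply/forallP => i; apply/forallP => j; rewrite !ffunE.
by have /forallP/(_ (f i))/forallP/(_ (f j)) := valP x.
Qed.

Definition reindex k l (f : 'I_l.+1 -> 'I_k.+1) (x : Fl k) : Fl l :=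
  Sub [ffun i => vertex x (f i)] (reindex_subproof f x).

Lemma Fl_map_subproof (f : V -> V) (f_adj : {homo f : u v / adj u v}) k
    (x : Fl k) : is_simplex [ffun i => f (vertex x i)].
Proof.
apply/forallP => i; apply/forallP => j; rewrite !ffunE.
have /forallP/(_ i)/forallP/(_ j) := valP x.
by move=> /orP[/eqP e|/f_adj ->]; rewrite ?orbT // /vertex e eqxx.
Qed.

Lemma triangle_subproof (u v w : V) : symmetric adj ->
  adj u v -> adj u w -> adj v w ->
  is_simplex [ffun i : 'I_3 => nth u [:: u; v; w] i].
Proof.
move=> sym uv uw vw; apply/forallP => -[[|[|[|//]]] ?];
  apply/forallP => -[[|[|[|//]]] ?];
  by rewrite !ffunE /= ?eqxx // ?uv ?uw ?vw 1?sym ?uv ?uw ?vw orbT.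
Qed.

Definition Fl_map (f : V -> V) (f_adj : {homo f : u v / adj u v}) k (x : Fl k) :
  Fl k := Sub [ffun i => f (vertex x i)] (Fl_map_subproof f_adj x).

Definition triangle (adj_sym : symmetric adj) (u v w : V)
    (uv : adj u v) (uw : adj u w) (vw : adj v w) : Fl 2 :=
  Sub [ffun i : 'I_3 => nth u [:: u; v; w] i] (triangle_subproof adj_sym uv uw vw).

Definition face k (i : 'I_k.+2) (x : Fl k.+1) : Fl k := reindex (fintype.lift i) x.

Definition chain k : lmodType int := {freeg (Fl k)}.

Definition boundary k : chain k.+1 -> chain k :=
  fglift (fun x => \sum_(i < k.+2) (-1) ^+ i *: (<< face i x >> : {freeg (Fl k)})).

Definition alt_rel k : set (chain k) :=
  [set c | exists2 x : Fl k,
     (exists mu nu : 'I_k.+1, (mu < nu)%N /\ vertex x mu = vertex x nu)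
     & c = << x >>] `|`
  [set c | exists (x : Fl k) (s : 'S_k.+1),
     c = << x >> - (-1) ^+ s *: (<< reindex s x >> : {freeg (Fl k)})].

Definition alt_chain k : zmodType := quot_gen (@alt_rel k).

Definition alt_class k (c : chain k) : alt_chain k := quot_class _ c.

Lemma alt_class_is_zmod_morphism k : zmod_morphism (@alt_class k).
Proof. exact: raddfB. Qed.

HB.instance Definition _ k :=
  GRing.isZmodMorphism.Build (chain k) (alt_chain k) (@alt_class k)
    (@alt_class_is_zmod_morphism k).

Definition alt_simplex k (x : Fl k) : alt_chain k := alt_class << x >>.

Definition alt_boundary k (c : alt_chain k.+1) : alt_chain k :=
  alt_class (boundary (quot_repr c)).

Lemma alt_class_eq0 k (c : chain k) :
  (alt_class c == 0) = (c \in subgroup_gen (@alt_rel k)).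
Proof. by rewrite -[RHS](congr1 (fun d => d \in _) (subr0 c)) quot_classP raddf0. Qed.

Lemma alt_classZ k (m : int) (c : chain k) :
  alt_class (m *: c) = alt_class c *~ m.
Proof. by rewrite -[m in LHS]intz scaler_int raddfMz. Qed.

Lemma alt_simplex_degenerate k (x : Fl k) (mu nu : 'I_k.+1) :
  mu != nu -> vertex x mu = vertex x nu -> alt_simplex x = 0.
Proof.
move=> mn xmn; apply/eqP; rewrite alt_class_eq0; apply: mem_subgroup_gen; left.
exists x => //; case: (ltngtP mu nu) => [lt|gt|/val_inj e].
- by exists mu, nu.
- by exists nu, mu.
- by rewrite e eqxx in mn.
Qed.

Lemma alt_simplex_perm k (x : Fl k) (s : 'S_k.+1) :
  alt_simplex x = alt_simplex (reindex s x) *~ (-1) ^+ s.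
Proof.
rewrite -alt_classZ; apply/eqP; rewrite -subr_eq0 -raddfB alt_class_eq0.
by apply: mem_subgroup_gen; right; exists x, s.
Qed.

Lemma lift_permE k (s : 'S_k.+1) i : exists s', s = lift_perm i (s i) s'.
Proof.
pose t := (s * lift_perm (s i) i 1)%g.
have ti : t i = i by rewrite permM lift_perm_id.
have tl j : {j' | t (fintype.lift i j) = fintype.lift i j'}.
  case: (unliftP i (t (fintype.lift i j))) => [j' ->|e]; first by exists j'.
  by have := neq_lift i j; rewrite -(inj_eq (@perm_inj _ t)) ti e eqxx.
have inj : injective (fun j => sval (tl j)).
  move=> j1 j2; case: (tl j1) => a /= ea; case: (tl j2) => b /= eb ab.
  apply: (@lift_inj _ i); apply: (@perm_inj _ t); by rewrite ea eb ab.
exists (perm inj); apply/permP => j; case: (unliftP i j) => [m ->|->].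
  rewrite lift_perm_lift permE; case: (tl m) => a /= ea.
  apply: (@perm_inj _ (lift_perm (s i) i 1)).
  by rewrite lift_perm_lift perm1 -ea permM.
by rewrite lift_perm_id.
Qed.

Lemma boundaryE k (x : Fl k.+1) :
  alt_class (boundary << x >>) =
  \sum_(i < k.+2) alt_simplex (face i x) *~ (-1) ^+ i.
Proof.
rewrite /boundary liftU scale1r raddf_sum; apply: eq_bigr => i _.
exact: alt_classZ.
Qed.

Lemma boundary_is_zmod_morphism k : zmod_morphism (@boundary k).
Proof. exact: lift_is_additive. Qed.

HB.instance Definition _ k :=
  GRing.isZmodMorphism.Build (chain k.+1) (chain k) (@boundary k)
    (@boundary_is_zmod_morphism k).

Lemma face_perm k (x : Fl k.+1) (s : 'S_k.+2) i :
  alt_simplex (face (s i) x) *~ (-1) ^+ (s i) =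
  alt_simplex (face i (reindex s x)) *~ (-1) ^+ i *~ (-1) ^+ s.
Proof.
have [s' es] := lift_permE s i.
rewrite (alt_simplex_perm _ s') -!mulrzA; congr (alt_simplex _ *~ _).
  apply/val_inj/ffunP => j; rewrite !ffunE /vertex /= !ffunE /vertex.
  by rewrite [in RHS]es lift_perm_lift.
rewrite [in RHS]es odd_lift_perm -[LHS]exprD -[RHS]exprD.
rewrite -[LHS]signr_odd -[RHS]signr_odd !oddD !oddb; congr (_ ^+ _).
by case: (odd i); case: (odd (s i)); case: (odd_perm s').
Qed.

Lemma boundary_alt_rel k (c : chain k.+1) :
  alt_rel c -> alt_class (boundary c) = 0.
Proof.
move=> [[x [mu [nu [mn xmn]]] ->]|[x [s ->]]]; last first.
  have bZ (m : int) d : boundary (m *: d) = m *: boundary d :> chain k.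
    by rewrite -[m]intz !scaler_int raddfMz.
  rewrite !raddfB /= bZ alt_classZ !boundaryE.
  apply/eqP; rewrite subr_eq0 (reindex_inj (@perm_inj _ s)) /= mulrz_suml.
  by apply/eqP/eq_bigr => i _; rewrite face_perm.
have mn' : mu != nu by apply: contraTneq mn => ->; rewrite ltnn.
rewrite boundaryE (bigD1 mu) //= (bigD1 nu) 1?eq_sym //= big1 => [|i /andP[im inu]].
  have xt : reindex (tperm mu nu) x = x.
    apply/val_inj/ffunP => j; rewrite ffunE /vertex.
    by case: tpermP => [->|->|//].
  have := face_perm x (tperm mu nu) mu.
  rewrite xt tpermL odd_tperm mn' expr1 mulrNz mulr1z => ->.
  by rewrite addr0 subrr.
have [mu' emu _] := unlift_some im.
have [nu' enu _] := unlift_some inu.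
rewrite (@alt_simplex_degenerate _ _ mu' nu') ?mul0rz //.
  by apply: contra_neq mn' => e; rewrite emu enu e.
by rewrite /vertex !ffunE -emu -enu.
Qed.

(* the boundary of the alternating complex is the induced one *)
Lemma alt_boundary_class k (c : chain k.+1) :
  alt_boundary (alt_class c) = alt_class (boundary c).
Proof.
apply/eqP; rewrite -subr_eq0 -!raddfB.
pose P : {pred chain k.+1} := fun c => alt_class (boundary c) == 0.
apply: (@subgroup_gen_min _ (@alt_rel k.+1) P); last first.
- by rewrite quot_classP quot_reprK.
- by move=> d /boundary_alt_rel e; apply/eqP.
split=> [|a b /eqP ea /eqP eb]; first by rewrite /in_mem /= /P !raddf0.
by rewrite /in_mem /= /P !raddfB /= ea eb subr0.
Qed.

Definition is_cocycle k (A : zmodType) (phi : {additive alt_chain k -> A}) :=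
  forall c : alt_chain k.+1, phi (alt_boundary c) = 0.

End FlagComplex.

Section OppositionComplex.
Variables (D : nzRingType) (M : lmodType D^c) (h : M -> M -> D).

Definition opp_chain k : zmodType := alt_chain (@opposite D M h) k.

Definition opp_triangle (X Y Z : Lagrangian h) (XY : opposite X Y)
    (XZ : opposite X Z) (YZ : opposite Y Z) : opp_chain 2 :=
  alt_simplex (triangle (@opposite_sym D M h) XY XZ YZ).

(* Invariance is tested on the cosets <x_0, ..., x_k>, which generate. *)
Definition is_invariant k (A : zmodType) (phi : {additive opp_chain k -> A}) :=
  forall (g : isometry h) (x : Fl (@opposite D M h) k),
    phi (alt_simplex (Fl_map (isometry_homo g) x)) = phi (alt_simplex x).

End OppositionComplex.

(* Main.v *)
Require Import Defs.
From HB Require Import structures.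
From mathcomp Require Import all_boot all_order perm all_algebra.
From mathcomp Require Import boolp classical_sets functions.
From mathcomp Require Import freeg.
Import GRing.Theory.
Local Open Scope ring_scope.

(** Write W t for the Witt class of t, and (+) for orthogonal sums, with e1, e2,
    e3 for the tuples of standard vectors of the summands.

    (i) In r (+) (-r) (+) r the tuples e1 + e2 and e2 + e3 are isotropic and pair
    to -r, while e1 + e2 + e3 is orthogonal to both and has Gram matrix r.  Hence
    the sum is congruent to H (+) r, where H is the hyperbolic form with blocks
    0, -r, -r, 0 ([block_hyperbolic]); cancelling W r in the group leaves
    W r + W (-r) = 0.  In characteristic 2 the form r (+) (-r) is metabolic but
    may fail to be hyperbolic; hence the third summand.

    (ii) If r + s + t = 0, then in r (+) s the tuples e1 + e2 and
    e1 r^-1 - e2 s^-1 are orthogonal, with Gram matrices r + s = -t and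
    r^-J + s^-J = -u.  So r (+) s is congruent to (-t) (+) (-u), and (i) gives
    the four-term relation ([Witt_add]).

    The cocycle.  Call (x, y, t) adapted to Lagrangians (X, Y, Z) if x and y are
    dual bases of X and Y and y + x t is a basis of Z.  Three facts about
    adapted triples carry the proof:
    - exchanging X and Y turns t into -t^-J, which is congruent to -t
      ([adapted_swap12]);
    - if a and b belong to (X, Y, Z) and (X, Y, U) for the same x and y, then
      b - a belongs to (X, Z, U) for x and y + x a ([adapted_sub]); for U = Y
      this says that exchanging Y and Z turns t into -t;
    - two matrices adapted to the same triple are congruent, and every congruent
      matrix occurs ([kappa_isoclass]).
    By the first two, W (kappa (X, Y, Z)) is alternating.  For four pairwise
    opposite Lagrangians with matrices a and b as above, its values on the four
    faces are W a, W b, W (b - a) and W (a^-J - b^-J), and the cocycle identity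
    is (ii) for the matrices b, -a, a - b.

    That pairwise opposite Lagrangians have adapted bases of the right size is
    linear algebra over a division ring.  A dual system of maximal length in
    X and Y spans both ([dual_spanning]), because a vector of X outside its span
    would, as X meets Y = Y^perp in 0, pair nontrivially with a vector of Y and
    enlarge the system.  The length is the rank of M because a homogeneous linear
    system with more unknowns than equations has a nonzero solution. *)

Set Implicit Arguments.
Unset Strict Implicit.
Unset Printing Implicit Defensive.

(** * Conjugate transposes and signs *)

Section Matrices.
Variables (D : nzRingType) (J : involution D).

Lemma invN x : J (- x) = - J x.
Proof. by apply/eqP; rewrite -addr_eq0 -inv_add addNr Defs.inv0. Qed.

Lemma jtrD m n (a b : 'M[D]_(m, n)) : jtr J (a + b) = jtr J a + jtr J b.
Proof. by apply/matrixP => i j; rewrite !mxE inv_add. Qed.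

Lemma jtrN m n (a : 'M[D]_(m, n)) : jtr J (- a) = - jtr J a.
Proof. by apply/matrixP => i j; rewrite !mxE invN. Qed.

Lemma jtr0 m n : jtr J (0 : 'M[D]_(m, n)) = 0.
Proof. by apply/matrixP => i j; rewrite !mxE Defs.inv0. Qed.

Lemma jtr_block m1 m2 n1 n2 (a : 'M[D]_(m1, n1)) (b : 'M[D]_(m1, n2))
    (c : 'M[D]_(m2, n1)) (d : 'M[D]_(m2, n2)) :
  jtr J (block_mx a b c d) = block_mx (jtr J a) (jtr J c) (jtr J b) (jtr J d).
Proof. by rewrite /jtr tr_block_mx map_block_mx. Qed.

Lemma jtr_row m n1 n2 (a : 'M[D]_(m, n1)) (b : 'M[D]_(m, n2)) :
  jtr J (row_mx a b) = col_mx (jtr J a) (jtr J b).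
Proof. by rewrite /jtr tr_row_mx map_col_mx. Qed.

Lemma jtr_col m1 m2 n (a : 'M[D]_(m1, n)) (b : 'M[D]_(m2, n)) :
  jtr J (col_mx a b) = row_mx (jtr J a) (jtr J b).
Proof. by rewrite /jtr tr_col_mx map_row_mx. Qed.

Lemma is_inverse_opp n (a b : 'M[D]_n) : is_inverse a b -> is_inverse (- a) (- b).
Proof. by move=> [ab ba]; split; rewrite mulNmx mulmxN opprK. Qed.

Lemma is_inverse_sym n (a b : 'M[D]_n) : is_inverse a b -> is_inverse b a.
Proof. by case. Qed.

Variable eps : D.
Hypothesis eps_sign : eps = 1 \/ eps = -1.

Lemma opp_sign : - eps = 1 \/ - eps = -1.
Proof. by case: eps_sign => ->; rewrite ?opprK; [right|left]. Qed.

Lemma sign_sq : eps * eps = 1.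
Proof. by case: eps_sign => ->; rewrite ?mulrNN mulr1. Qed.

Lemma sign_comm x : x * eps = eps * x.
Proof. by case: eps_sign => ->; rewrite ?mulrN ?mulNr mulr1 mul1r. Qed.

Lemma inv_sign : J eps = eps.
Proof. by case: eps_sign => ->; rewrite ?invN Defs.inv1. Qed.

Lemma mx_sign_sq n : eps%:M *m eps%:M = 1%:M :> 'M_n.
Proof. by rewrite -scalar_mxM sign_sq. Qed.

Lemma mx_sign_comm m n (a : 'M[D]_(m, n)) : a *m eps%:M = eps%:M *m a.
Proof.
case: eps_sign => ->; first by rewrite mulmx1 mul1mx.
by rewrite !raddfN /= ?(mulNmx, mulmxN) mulmx1 mul1mx.
Qed.

Lemma jtr_sign n : jtr J (eps%:M : 'M[D]_n) = eps%:M.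
Proof.
apply/matrixP => i j; rewrite !mxE eq_sym.
by case: eqP => _; rewrite ?Defs.inv0 ?inv_sign.
Qed.

Lemma hermitian_jtr n (t : 'M[D]_n) :
  is_hermitian J eps t -> jtr J t = t *m eps%:M.
Proof. by move=> h; rewrite {2}h -mulmxA mx_sign_sq mulmx1. Qed.

Lemma hermitian_opp n (t : 'M[D]_n) :
  is_hermitian J eps t -> is_hermitian J eps (- t).
Proof. by rewrite /is_hermitian jtrN mulNmx => <-. Qed.

Lemma hermitian_add n (t s : 'M[D]_n) :
  is_hermitian J eps t -> is_hermitian J eps s -> is_hermitian J eps (t + s).
Proof. by rewrite /is_hermitian jtrD mulmxDl => <- <-. Qed.

Lemma jtr_hermitian n (t : 'M[D]_n) :
  is_hermitian J eps t -> is_hermitian J eps (jtr J t).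
Proof. by move=> ht; rewrite /is_hermitian jtrK hermitian_jtr. Qed.

(** Both [jtr J b] and [b *m eps%:M] invert [jtr J t = t *m eps%:M]. *)
Lemma hermitian_inv n (t b : 'M[D]_n) :
  is_inverse t b -> is_hermitian J eps t -> is_hermitian J eps b.
Proof.
move=> tb ht.
have e : is_inverse (jtr J t) (b *m eps%:M).
  rewrite hermitian_jtr //; case: tb => tb bt; split.
    by rewrite (mx_sign_comm b) mulmxA -[t *m _ *m _]mulmxA mx_sign_sq mulmx1.
  by rewrite (mx_sign_comm t) mulmxA -[b *m _ *m _]mulmxA mx_sign_sq mulmx1.
rewrite /is_hermitian -(minv_eq (is_inverse_jtr J tb)) (minv_eq e).
by rewrite -mulmxA mx_sign_sq mulmx1.
Qed.

End Matrices.

(** * Classes in the Witt group *)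

Lemma quot_class_gen (V : zmodType) (S : set V) x : S x -> quot_class S x = 0.
Proof.
move=> Sx; apply/eqP; rewrite -[0](raddf0 (quot_class S)) -quot_classP subr0.
exact: mem_subgroup_gen.
Qed.

Section WittClasses.
Variables (D : nzRingType) (J : involution D) (eps : D).

Notation W t := (Witt_class (Herm_class t)).

Lemma Witt_isoclass n (r s : nsherm J eps n) : isoclass J r s -> W r = W s.
Proof. by move=> /isoclass_eq e; congr Witt_class; apply/val_inj. Qed.

Lemma Witt_congruent n (r s : nsherm J eps n) (p : 'M[D]_n) :
  nonsingular p -> jtr J p *m r *m p = s -> W r = W s.
Proof. by move=> pI e; apply/Witt_isoclass/isoclassP; exists p. Qed.

Lemma Witt_mx_eq n (r s : nsherm J eps n) : nsherm_mx r = s -> W r = W s.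
Proof. by move=> e; apply: Witt_isoclass; rewrite e; apply: isoclass_refl. Qed.

Lemma Witt_osum m n (r : nsherm J eps m) (s : nsherm J eps n) :
  W (osum r s) = W r + W s.
Proof.
rewrite /Witt_class -raddfD; congr (quot_class _ _).
rewrite /GW_class -isosum_class; set c := isocls _; set d := isocls _.
apply/eqP; rewrite -subr_eq0 opprD addrA /completion_class -!raddfB.
by apply/eqP/quot_class_gen; exists (c, d).
Qed.

Lemma Witt_hyperbolic n (t : nsherm J eps n) m :
  is_hyperbolic J eps m (mx_form J t) -> W t = 0.
Proof.
move=> H; apply: quot_class_gen; exists (isocls (Herm_class t)) => //=.
by exists m, t => //=; apply: isoclass_refl.
Qed.

Lemma Witt_dim0 (t : nsherm J eps 0) : W t = 0.
Proof.
have e : isocls (Herm_class (osum t t)) = isocls (Herm_class t) :> isoclasses J eps.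
  congr isocls; apply/Herm_class_eq.
  rewrite [X in isoclass _ X _]thinmx0 [X in isoclass _ _ X]thinmx0.
  exact: isoclass_refl.
by apply: (addrI (W t)); rewrite addr0 -Witt_osum /Witt_class e.
Qed.

End WittClasses.

(** * Hyperbolic forms *)

Section DualSpace.
Variables (D : nzRingType) (J : involution D) (X : lmodType D^c).
Implicit Types xi eta : jdual X J.

Lemma jdualD xi u v : xi (u + v) = xi u + xi v.
Proof. by have /asboolP[xiD _] := valP xi; apply: xiD. Qed.

Lemma jdualZ xi u a : xi (u *:> a) = xi u * a.
Proof. by have /asboolP[_ xiZ] := valP xi; apply: xiZ. Qed.

Lemma jdual0 xi : xi 0 = 0.
Proof. by apply: (addrI (xi 0)); rewrite -jdualD !addr0. Qed.

Lemma jdual_sum xi n (F : 'I_n -> X) : xi (\sum_i F i) = \sum_i xi (F i).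
Proof. exact: (big_morph xi (jdualD xi) (jdual0 xi)). Qed.

Lemma jdual_addE xi eta u : jdual_fun (xi + eta) u = xi u + eta u.
Proof. by []. Qed.

Lemma jdual_scaleE xi a u : jdual_fun (xi *:> a) u = J a * xi u.
Proof. by []. Qed.

Lemma jdual_zeroE u : jdual_fun (0 : jdual X J) u = 0.
Proof. by []. Qed.

End DualSpace.

Section HyperbolicBlock.
Variables (D : nzRingType) (J : involution D) (n : nat).
Implicit Types (s : 'M[D]_n) (w : 'cV[D^c]_n).

Local Notation X := ('cV[D^c]_n : vectType D^c).

Lemma mulmx_rscale m p (a : 'M[D]_(m, p)) (v : 'cV[D^c]_p) (c : D^c) i :
  (a *m (c *: v : 'cV[D^c]_p)) i 0 = (a *m (v : 'cV[D]_p)) i 0 * c :> D.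
Proof.
rewrite !mxE mulr_suml; apply: eq_bigr => j _.
by rewrite mxE -mulrA.
Qed.

Lemma mx_form_rlinear s w : mx_form J s w \in rlinear (X := X).
Proof.
apply/asboolP; split=> [u v|u a]; rewrite /mx_form.
  by rewrite mulmxDr mxE.
exact: mulmx_rscale.
Qed.

Definition mx_form_dual s w : jdual X J := SigSub (mx_form_rlinear s w).

Lemma mx_form_dual_linear s : linear (mx_form_dual s).
Proof.
move=> a u v; apply/val_inj/funext => y; rewrite /= /mx_form /=.
rewrite jtrD !mulmxDl mxE; congr (_ + _).
rewrite /jdual_fun /= /mx_form -!mulmxA !mxE mulr_sumr; apply: eq_bigr => i _.
by rewrite !mxE inv_mul mulrA.
Qed.

HB.instance Definition _ s := GRing.isLinear.Build D^c 'cV[D^c]_n (jdual X J) _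
  (mx_form_dual s) (mx_form_dual_linear s).

Lemma mx_form_dual_bij s : nonsingular s -> bijective (mx_form_dual s).
Proof.
move=> [b [sb bs]].
pose rho (xi : jdual X J) : 'rV[D]_n := \row_i xi (delta_mx i 0).
have rhoP (xi : jdual X J) y : xi y = (rho xi *m (y : 'cV[D]_n)) 0 0.
  rewrite {1}[y]matrix_sum_delta mxE jdual_sum; apply: eq_bigr => i _.
  by rewrite big_ord1 mxE; apply: jdualZ.
have rho_dual w : rho (mx_form_dual s w) = jtr J w *m s.
  by apply/rowP => i; rewrite mxE /jdual_fun /= /mx_form -colE mxE.
exists (fun xi => jtr J (rho xi *m b)) => [w|xi].
  by rewrite rho_dual -mulmxA sb mulmx1 jtrK.
apply/val_inj/funext => y; rewrite -[RHS]/(jdual_fun xi y) rhoP /= /mx_form.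
by rewrite jtrK -[_ *m b *m s]mulmxA bs mulmx1.
Qed.

(** The isometry of the form with blocks 0, s, s, 0 onto the hyperbolic module
    on [X]: the second half of the coordinates becomes a linear form on the
    first half, through [s]. *)
Definition block_split s (u : 'cV[D^c]_(n + n)) : (X * jdual X J)%type :=
  (usubmx u, mx_form_dual s (dsubmx u)).

Lemma block_split_linear s : linear (block_split s).
Proof. by move=> a u v; rewrite /block_split !linearP. Qed.

HB.instance Definition _ s := GRing.isLinear.Build D^c 'cV[D^c]_(n + n) _ _
  (block_split s) (block_split_linear s).

Lemma block_hyperbolic (eps : D) s : eps = 1 \/ eps = -1 ->
  nonsingular s -> is_hermitian J eps s ->
  exists m, is_hyperbolic J eps m (mx_form J (block_mx 0 s s 0)).
Proof.
move=> he sI sH; exists (dim X), X; split; first reflexivity.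
exists (block_split s).
  have [k pk kp] := mx_form_dual_bij sI.
  exists (fun p => col_mx p.1 (k p.2)) => [u|[x xi]].
    by rewrite /block_split /= pk vsubmxK.
  by rewrite -[LHS]/(usubmx _, mx_form_dual s (dsubmx _)) col_mxKu col_mxKd kp.
move=> u v; rewrite /hyp_form /= /jdual_fun /=.
rewrite -[u in LHS]vsubmxK -[v in LHS]vsubmxK /mx_form jtr_col mul_row_block.
rewrite !mulmx0 add0r addr0 mul_row_col mxE; congr (_ + _).
set a := dsubmx v; set b := usubmx u.
have -> : jtr J (b : 'cV[D]_n) *m s *m a =
    jtr J (jtr J (a : 'cV[D]_n) *m s *m b) *m eps%:M.
  rewrite !jtr_mul jtrK (hermitian_jtr he sH) -[s *m _ *m _]mulmxA.
  rewrite -(mx_sign_comm he a) !mulmxA -[_ *m eps%:M *m _]mulmxA.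
  by rewrite mx_sign_sq // mulmx1.
by rewrite mxE big_ord1 !mxE eqxx mulr1n.
Qed.

End HyperbolicBlock.

(** * Relations between Witt classes *)

Definition block_calc := (@mulmx_block, @mul_row_col, @mul_col_row, @mul_block_col,
  @mul_row_block, @add_block_mx, @add_col_mx, @add_row_mx, @mul_col_mx,
  @opp_row_mx, @opp_col_mx, @oppr0, @mulmx1, @mul1mx, @mulmx0, @mul0mx,
  @mulmxN, @mulNmx, @addr0, @add0r, @opprK, @addrN, @addNr, @subrr).

Section WittRelations.
Variables (D : nzRingType) (J : involution D) (eps : D).
Hypothesis eps_sign : eps = 1 \/ eps = -1.

Notation W t := (Witt_class (Herm_class t)).

Lemma block_nonsingular n (s : 'M[D]_n) :
  nonsingular s -> nonsingular (block_mx 0 s s 0).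
Proof.
move=> [b [sb bs]]; exists (block_mx 0 b b 0).
by split; rewrite !block_calc ?sb ?bs -scalar_mx_block.
Qed.

Lemma block_hermitian n (s : 'M[D]_n) :
  is_hermitian J eps s -> is_hermitian J eps (block_mx 0 s s 0).
Proof.
by rewrite /is_hermitian jtr_block !jtr0 scalar_mx_block !block_calc => <-.
Qed.

Definition block_herm n (s : nsherm J eps n) : nsherm J eps (n + n) :=
  NsHerm (block_nonsingular (nsherm_nonsingular s))
         (block_hermitian (nsherm_hermitian s)).

Lemma Witt_block n (s : nsherm J eps n) : W (block_herm s) = 0.
Proof.
have [m] := block_hyperbolic eps_sign (nsherm_nonsingular s) (nsherm_hermitian s).
exact: (@Witt_hyperbolic _ _ _ _ (block_herm s)).
Qed.

(** The form [r (+) s (+) r] is congruent to [block_herm s (+) r]; this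
    determines [W r + W s] because the Witt group allows cancellation. *)
Lemma Witt_add_eq0 n (r s : nsherm J eps n) :
  nsherm_mx r + nsherm_mx s = 0 -> W r + W s = 0.
Proof.
move=> /eqP; rewrite addrC addr_eq0 => /eqP sE.
suff : W (osum (osum r s) r) = W (osum (block_herm s) r).
  by rewrite 3!Witt_osum Witt_block => e; apply: (addIr (W r)).
(* The columns of P are e1 + e2, e2 + e3 and e1 + e2 + e3. *)
pose P : 'M[D]_(n + n + n) :=
  block_mx (block_mx 1%:M 0 1%:M 1%:M) (col_mx 1%:M 1%:M) (row_mx 0 1%:M) 1%:M.
pose Q : 'M[D]_(n + n + n) :=
  block_mx (block_mx 0 1%:M (- 1%:M) 1%:M) (col_mx (- 1%:M) 0)
           (row_mx 1%:M (- 1%:M)) 1%:M.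
have I2 : block_mx 1%:M 0 0 1%:M = 1%:M :> 'M[D]_(n + n).
  by rewrite -scalar_mx_block.
have I3 : block_mx 1%:M 0 0 1%:M = 1%:M :> 'M[D]_(n + n + n).
  by rewrite -scalar_mx_block.
apply: (@Witt_congruent _ _ _ _ _ _ P).
  exists Q; split; rewrite /P /Q.
    by rewrite -I3 -I2 !block_calc addrK ?col_mx0 ?row_mx0.
  by rewrite -I3 -I2 !block_calc ?col_mx0 ?row_mx0.
rewrite /= sE /osum_mx /P !(jtr_block, jtr_row, jtr_col, jtr1, jtr0, block_calc).
by rewrite !mul_mx_row !block_calc col_mx0 row_mx0.
Qed.

Lemma nonsingular_opp n (s : 'M[D]_n) : nonsingular s -> nonsingular (- s).
Proof. by case=> b sb; exists (- b); apply: is_inverse_opp. Qed.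

Definition opp_herm n (s : nsherm J eps n) : nsherm J eps n :=
  NsHerm (nonsingular_opp (nsherm_nonsingular s))
         (hermitian_opp (nsherm_hermitian s)).

Lemma Witt_opp n (s : nsherm J eps n) : W (opp_herm s) = - W s.
Proof.
by apply/eqP; rewrite -addr_eq0; apply/eqP/Witt_add_eq0; rewrite /= addNr.
Qed.

(** The base change with columns [e1 + e2] and [e1 r^-1 - e2 s^-1] takes
    [r (+) s] to [(-t) (+) (-u)]. *)
Lemma Witt_add n (r s t : nsherm J eps n) :
  nsherm_mx r + nsherm_mx s + nsherm_mx t = 0 ->
  exists2 u : nsherm J eps n,
    nsherm_mx u = - minv (jtr J r) - minv (jtr J s) &
    W r + W s + W t + W u = 0.
Proof.
move=> rst.
have [r' rI] := nsherm_nonsingular r; have [rr' r'r] := rI.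
have [s' sI] := nsherm_nonsingular s; have [ss' s's] := sI.
have [t' tI] := nsherm_nonsingular t.
pose a : 'M[D]_n := jtr J r'; pose b : 'M[D]_n := jtr J s'.
have aE : minv (jtr J r) = a by apply/minv_eq/is_inverse_jtr.
have bE : minv (jtr J s) = b by apply/minv_eq/is_inverse_jtr.
have tE : nsherm_mx t = - (nsherm_mx r + nsherm_mx s).
  by apply/eqP; rewrite eq_sym eqr_oppLR -addr_eq0 rst.
have rsE : r' + s' = - (r' *m t *m s').
  rewrite tE mulmxN mulNmx opprK mulmxDr mulmxDl r'r mul1mx.
  by rewrite -mulmxA ss' mulmx1 addrC.
have rtsI : is_inverse (r' *m t *m s') (s *m (t' *m r)).
  by do !apply: is_inverse_mul => //; apply: is_inverse_sym.
have hr' := hermitian_inv eps_sign rI (nsherm_hermitian r).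
have hs' := hermitian_inv eps_sign sI (nsherm_hermitian s).
have u_ns : nonsingular (- a - b).
  rewrite -opprD -jtrD rsE jtrN opprK; exists (jtr J (s *m (t' *m r))).
  exact: is_inverse_jtr.
have u_herm : is_hermitian J eps (- a - b).
  by apply: hermitian_add; apply/hermitian_opp/jtr_hermitian.
exists (NsHerm u_ns u_herm); first by rewrite aE bE.
suff -> : W r + W s = - W t - W (NsHerm u_ns u_herm).
  by rewrite addrAC subrK addNr.
rewrite -!Witt_opp -!Witt_osum.
have Pns : nonsingular (block_mx 1%:M r' 1%:M (- s')).
  have -> : block_mx 1%:M r' 1%:M (- s') =
      block_mx 1%:M 0 1%:M 1%:M *m block_mx 1%:M r' 0 (r' *m t *m s').
    by rewrite !block_calc -[r' *m t *m s']opprK -rsE opprD addNKr.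
  move: rtsI; set c := r' *m t *m s'; set d := s *m _ => -[cd dc].
  exists (block_mx 1%:M (- (r' *m d)) 0 d *m block_mx 1%:M 0 (- 1%:M) 1%:M).
  apply: is_inverse_mul; split; rewrite !block_calc ?cd ?dc -?scalar_mx_block //.
  by rewrite -mulmxA dc mulmx1 addrN -scalar_mx_block.
apply: (Witt_congruent Pns).
rewrite /= /osum_mx jtr_block jtrN -/a -/b jtr1 !block_calc.
have ar : a *m r = eps%:M.
  by rewrite /a (hermitian_jtr eps_sign hr') -mulmxA -mx_sign_comm // mulmxA r'r mul1mx.
have bs : b *m s = eps%:M.
  by rewrite /b (hermitian_jtr eps_sign hs') -mulmxA -mx_sign_comm // mulmxA s's mul1mx.
rewrite rr' ss' addrN -!mulmxA rr' ss' !mulmx1 ar bs addrN opprD !opprK.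
by rewrite tE opprK.
Qed.

End WittRelations.

(** * Linear systems over a division ring *)

Section DivisionRing.
Variable D : unitRingType.
Hypothesis divD : GRing.field_axiom D.

(** Gaussian elimination: unless the first equation is trivial, it has a pivot
    after a permutation of the unknowns, whose Schur complement has one equation
    and one unknown less. *)
Lemma homogeneous_system m n (b : 'M[D]_(m, n)) :
  (m < n)%N -> exists2 c : 'cV[D]_n, c != 0 & b *m c = 0.
Proof.
elim: m n b => [|m IH] [//|n] b ltmn.
  exists (const_mx 1); last by rewrite [_ *m _]flatmx0.
  by apply/eqP => /matrixP/(_ 0 0)/eqP; rewrite !mxE oner_eq0.
have [b0|[j bj]] : (forall j, b 0 j = 0) \/ exists j, b 0 j != 0.
  have [/existsP|/existsPn b0] := boolP [exists j, b 0 j != 0]; first by right.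
  by left=> j; apply/eqP; rewrite -[_ == _]negbK b0.
  pose B : 'M[D]_(1 + m, n.+1) := b.
  have [c c0 bc] := IH _ (dsubmx B) (ltnW ltmn); exists c => //.
  rewrite -[LHS]/(B *m c) -[B]vsubmxK mul_col_mx bc.
  have -> : usubmx B = 0 by apply/matrixP => i j; rewrite !mxE ord1 lshift0 b0.
  by rewrite mul0mx col_mx0.
wlog j0 : b j bj / j = 0.
  move=> wl; have [|c c0 bc] := wl (xcol j 0 b) 0 _ erefl.
    by rewrite !mxE tpermR.
  exists (xrow j 0 c).
    apply: contra c0 => /eqP /(congr1 (xrow j 0)).
    by rewrite /xrow -row_permM tperm2 row_perm1 row_permE mulmx0 => ->.
  by rewrite xrowE mulmxA -xcolE.
rewrite {j}j0 in bj.
pose B : 'M[D]_(1 + m, 1 + n) := b.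
pose p := B 0 0; have pU : p \is a GRing.unit by apply: divD.
have [c c0 bc] := IH _ (drsubmx B - dlsubmx B *m (p^-1)%:M *m ursubmx B) ltmn.
exists (col_mx (- ((p^-1)%:M *m ursubmx B *m c)) c : 'cV_(1 + n)).
  apply: contra c0 => /eqP /(congr1 (@dsubmx _ 1 n 1)); rewrite col_mxKd => ->.
  by apply/eqP/matrixP => i k; rewrite !mxE.
rewrite -[LHS]/(B *m (col_mx _ _ : 'cV_(1 + n))) -[B in LHS]submxK.
rewrite mul_block_col !mulmxN.
have -> : ulsubmx B = p%:M.
  by apply/matrixP => i k; rewrite !mxE !ord1 !lshift0 eqxx mulr1n.
rewrite !mulmxA -scalar_mxM mulrV // mul1mx block_mxKur addNr addrC.
move: bc; rewrite mulmxBl => ->.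
by rewrite col_mx0.
Qed.

Lemma right_inverse_leq m n (a : 'M[D]_(m, n)) (b : 'M[D]_(n, m)) :
  a *m b = 1%:M -> (m <= n)%N.
Proof.
move=> ab; rewrite leqNgt; apply/negP => /(homogeneous_system b)[c c0 bc].
by case/eqP: c0; rewrite -[c]mul1mx -ab -mulmxA bc mulmx0.
Qed.

End DivisionRing.

(** * Families of vectors and their Gram matrices *)

Section Combinations.
Variables (D : nzRingType) (M : lmodType D^c).

Lemma rscale_sumr (v : M) m (F : 'I_m -> D) :
  v *:> (\sum_i F i) = \sum_i v *:> F i.
Proof. exact: (@scaler_suml D^c M v _ _ xpredT F). Qed.

(** The product of the row of vectors [u] and the matrix [a]. *)
Definition comb m n (u : 'I_m -> M) (a : 'M[D]_(m, n)) : 'I_n -> M :=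
  fun j => \sum_i u i *:> a i j.

Lemma comb1 m (u : 'I_m -> M) : comb u 1%:M = u.
Proof.
apply/funext => j; rewrite /comb (bigD1 j) //= mxE eqxx big1 ?addr0 => [|i ij].
  exact: scale1r.
by rewrite mxE (negPf ij); apply: scale0r.
Qed.

Lemma combA m n p (u : 'I_m -> M) (a : 'M[D]_(m, n)) (b : 'M[D]_(n, p)) :
  comb (comb u a) b = comb u (a *m b).
Proof.
apply/funext => j; rewrite /comb.
under eq_bigr => k _ do rewrite /rscale scaler_sumr.
rewrite exchange_big; apply: eq_bigr => i _.
rewrite mxE rscale_sumr; apply: eq_bigr => k _.
by rewrite /rscale scalerA.
Qed.

Lemma combDr m n (u : 'I_m -> M) (a b : 'M[D]_(m, n)) :
  comb u (a + b) = comb u a + comb u b.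
Proof.
apply/funext => j; rewrite /comb !fctE -big_split; apply: eq_bigr => i _.
by rewrite mxE; apply: scalerDl.
Qed.

Lemma combDl m n (u v : 'I_m -> M) (a : 'M[D]_(m, n)) :
  comb (u + v) a = comb u a + comb v a.
Proof.
apply/funext => j; rewrite /comb !fctE -big_split; apply: eq_bigr => i _.
exact: scalerDr.
Qed.

Lemma comb0 m n (u : 'I_m -> M) : comb u (0 : 'M[D]_(m, n)) = 0.
Proof.
by apply/funext => j; rewrite /comb big1 // => i _; rewrite mxE; apply: scale0r.
Qed.

Lemma combN m n (u : 'I_m -> M) (a : 'M[D]_(m, n)) : comb u (- a) = - comb u a.
Proof. by apply/eqP; rewrite -addr_eq0 -combDr addNr comb0. Qed.

Definition join m n (u : 'I_m -> M) (v : 'I_n -> M) : 'I_(m + n) -> M :=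
  fun i => match fintype.split i with inl j => u j | inr k => v k end.

Definition all_in (U : set M) m (u : 'I_m -> M) := forall i, U (u i).

Lemma all_in_join (U : set M) m n (u : 'I_m -> M) (v : 'I_n -> M) :
  all_in U u -> all_in U v -> all_in U (join u v).
Proof. by move=> Uu Uv i; rewrite /join; case: (fintype.split i). Qed.

Lemma basis_span (U : set M) m n (e : 'I_m -> M) (w : 'I_n -> M) :
  is_basis U e -> all_in U w -> exists a, w = comb e a.
Proof.
move=> [_ eB] Uw.
have /choice[c cE] : forall j, exists c : 'I_m -> D, w j = \sum_i e i *:> c i.
  by move=> j; have [c [cE _]] := eB _ (Uw j); exists c.
exists (\matrix_(i, j) c j i); apply/funext => j; rewrite cE.
by apply: eq_bigr => i _; rewrite mxE.
Qed.

End Combinations.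

Section Sesquilinear.
Variables (D : nzRingType) (J : involution D) (M : lmodType D^c).
Variables (h : M -> M -> D) (delta : D).

(** Additivity and semilinearity in the first argument follow from [formC]. *)
Record hermitian_form : Prop := HermitianForm {
  formDr : forall u v w, h u (v + w) = h u v + h u w;
  formZr : forall u v a, h u (v *:> a) = h u v * a;
  formC : forall u v, h u v = J (h v u) * delta }.

Hypothesis delta_sign : delta = 1 \/ delta = -1.
Hypothesis hF : hermitian_form.

Definition gram m n (u : 'I_m -> M) (v : 'I_n -> M) : 'M[D]_(m, n) :=
  \matrix_(i, j) h (u i) (v j).

Lemma form0r u : h u 0 = 0.
Proof. by apply: (addrI (h u 0)); rewrite -formDr // !addr0. Qed.

Lemma form_sumr u I (r : seq I) (F : I -> M) :
  h u (\sum_(i <- r) F i) = \sum_(i <- r) h u (F i).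
Proof. exact: (big_morph (h u) (formDr hF u) (form0r u)). Qed.

Lemma gramC m n (u : 'I_m -> M) (v : 'I_n -> M) :
  gram u v = jtr J (gram v u) *m delta%:M.
Proof.
apply/matrixP => i j; rewrite mx_sign_comm // mul_scalar_mx !mxE (formC hF).
exact: sign_comm.
Qed.

Lemma gramDr m n (u : 'I_m -> M) (v w : 'I_n -> M) :
  gram u (v + w) = gram u v + gram u w.
Proof. by apply/matrixP => i j; rewrite !mxE formDr. Qed.

Lemma gram_combr m n p (u : 'I_m -> M) (v : 'I_n -> M) (a : 'M_(n, p)) :
  gram u (comb v a) = gram u v *m a.
Proof.
apply/matrixP => i j; rewrite !mxE form_sumr; apply: eq_bigr => k _.
by rewrite mxE formZr.
Qed.

Lemma gram0r m n (u : 'I_m -> M) : gram u (0 : 'I_n -> M) = 0.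
Proof. by apply/matrixP => i j; rewrite !mxE form0r. Qed.

Lemma gramNr m n (u : 'I_m -> M) (v : 'I_n -> M) : gram u (- v) = - gram u v.
Proof. by apply/eqP; rewrite -addr_eq0 -gramDr addNr gram0r. Qed.

Lemma gramDl m n (u v : 'I_m -> M) (w : 'I_n -> M) :
  gram (u + v) w = gram u w + gram v w.
Proof. by rewrite gramC gramDr jtrD mulmxDl -!gramC. Qed.

Lemma gramNl m n (u : 'I_m -> M) (v : 'I_n -> M) : gram (- u) v = - gram u v.
Proof. by rewrite gramC gramNr jtrN mulNmx -gramC. Qed.

Lemma gram_combl m n p (u : 'I_m -> M) (v : 'I_n -> M) (a : 'M_(m, p)) :
  gram (comb u a) v = jtr J a *m gram u v.
Proof. by rewrite gramC gram_combr jtr_mul -mulmxA -gramC. Qed.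

Definition gramE := (gramDr, gramNr, gram_combr, gramDl, gramNl, gram_combl).

Lemma gram_join m1 m2 n1 n2 (u : 'I_m1 -> M) (v : 'I_m2 -> M)
    (w : 'I_n1 -> M) (z : 'I_n2 -> M) :
  gram (join u v) (join w z) = block_mx (gram u w) (gram u z) (gram v w) (gram v z).
Proof.
apply/matrixP => i j; rewrite !mxE /join.
by case: (fintype.split i) => k; rewrite mxE; case: (fintype.split j) => l; rewrite mxE.
Qed.

Lemma gram_dual_inj k m (x y : 'I_k -> M) (a b : 'M[D]_(k, m)) :
  gram y x = 1%:M -> comb x a = comb x b -> a = b.
Proof. by move=> yx e; rewrite -[a]mul1mx -[b]mul1mx -yx -!gram_combr e. Qed.

(** * Lagrangians *)

Implicit Types X Y Z : Lagrangian h.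
Notation "u \inL X" := (all_in (val X) u) (at level 70).

Lemma Lag_comb X m n (u : 'I_m -> M) (a : 'M[D]_(m, n)) :
  u \inL X -> comb u a \inL X.
Proof.
have [[X0 Xl] _] := set_valP X.
move=> Xu j; apply: set_mem.
apply: (big_ind (fun v => v \in mem (val X))) => // [v w Xv Xw|i _].
  by rewrite -[v]scale1r; apply: Xl.
by rewrite -[_ *:> _]addr0; apply: Xl => //; apply/mem_set/Xu.
Qed.

Lemma Lag_add X m (u v : 'I_m -> M) : u \inL X -> v \inL X -> u + v \inL X.
Proof.
have [[_ Xl] _] := set_valP X.
move=> Xu Xv i; rewrite !fctE -[u i]scale1r; apply: set_mem.
by apply: Xl; apply: mem_set; [exact: Xu|exact: Xv].
Qed.

Lemma Lag_opp X m (u : 'I_m -> M) : u \inL X -> - u \inL X.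
Proof. by move=> Xu; rewrite -[u]comb1 -combN; apply: Lag_comb. Qed.

Lemma Lag_sub_comb X m n (u : 'I_m -> M) (v : 'I_n -> M) a :
  u \inL X -> v \inL X -> v - comb u a \inL X.
Proof. by move=> Xu Xv; apply: Lag_add => //; apply/Lag_opp/Lag_comb. Qed.

Lemma Lag_gram X m n (u : 'I_m -> M) (v : 'I_n -> M) :
  u \inL X -> v \inL X -> gram u v = 0.
Proof.
have [_ XX] := set_valP X; rewrite /all_in => Xu; rewrite XX => Xv.
by apply/matrixP => i j; rewrite !mxE; apply: Xv.
Qed.

Lemma Lag_max X n (v : 'I_n -> M) :
  (forall m (u : 'I_m -> M), u \inL X -> gram u v = 0) -> v \inL X.
Proof.
have [_ XX] := set_valP X => Xv i; rewrite XX => u Xu.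
have /matrixP/(_ 0 i) := Xv 1%N (fun=> u) (fun=> Xu).
by rewrite !mxE.
Qed.

Lemma opposite_eq0 X Y m (u : 'I_m -> M) :
  opposite X Y -> u \inL X -> u \inL Y -> u = 0.
Proof.
move=> /asboolP XY Xu Yu; apply/funext => i.
have : [set 0]%classic (u i) by rewrite -XY.
by [].
Qed.

Definition spanning n (x y : 'I_n -> M) :=
  forall m (w : 'I_m -> M), exists a b, w = comb x a + comb y b.

Definition hyp_pair n (x y : 'I_n -> M) :=
  [/\ gram x x = 0, gram y y = 0 & gram y x = 1%:M].

Definition dual_in X Y k (x y : 'I_k -> M) :=
  [/\ x \inL X, y \inL Y & gram y x = 1%:M].

Lemma dual_in_hyp X Y k (x y : 'I_k -> M) : dual_in X Y x y -> hyp_pair x y.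
Proof.
by move=> [Xx Yy yx]; split; [apply: (Lag_gram Xx Xx)|apply: (Lag_gram Yy Yy)|].
Qed.

End Sesquilinear.

(** * Dual bases of opposite Lagrangians *)

Section DualBases.
Variables (D : unitRingType) (divD : GRing.field_axiom D).
Variables (J : involution D) (M : lmodType D^c).
Variables (h : M -> M -> D) (delta : D).
Hypothesis delta_sign : delta = 1 \/ delta = -1.
Hypothesis hF : hermitian_form J h delta.
Notation "u \inL X" := (all_in (val X) u) (at level 70).
Notation gram := (gram h).
Local Notation gramE := (gramE delta_sign hF).

(** The coordinates of [(x, y)] in terms of [(x0, y0)] form a 2n x 2k matrix.
    It has a left inverse, because the Gram matrix of [(x, y)] is invertible. *)
Lemma hyp_pair_leq k n (x y : 'I_k -> M) (x0 y0 : 'I_n -> M) :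
  hyp_pair h x y -> spanning x0 y0 -> (k <= n)%N.
Proof.
move=> [xx yy yx] sp; have [a [b xE]] := sp _ x; have [c [d yE]] := sp _ y.
have xy : gram x y = delta%:M by rewrite (gramC delta_sign hF) yx jtr1 mul1mx.
rewrite -leq_double -!addnn.
apply: (@right_inverse_leq _ divD _ _
  (block_mx (gram y x0) (gram y y0) (gram x x0) (gram x y0))
  (block_mx a c b d *m block_mx 1%:M 0 0 delta%:M)).
rewrite mulmxA mulmx_block -!(gram_combr hF) -!(gramDr hF) -xE -yE xx yy yx xy.
by rewrite !block_calc mx_sign_sq // -scalar_mx_block.
Qed.

Variables (n : nat) (x0 y0 : 'I_n -> M) (X Y : Lagrangian h).
Hypothesis h0 : hyp_pair h x0 y0.
Hypothesis s0 : spanning x0 y0.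
Hypothesis XY : opposite X Y.

(** The part [v'] of [v] orthogonal to [y] is nonzero and lies in [X], hence not
    in [Y = Y^perp].  So it pairs nontrivially with some [w] in [Y], which can
    be made orthogonal to [x] and normalized. *)
Lemma dual_in_extend k (x y : 'I_k -> M) (v : 'I_1 -> M) :
  dual_in X Y x y -> v \inL X -> v - comb x (gram y v) != 0 ->
  exists x' y' : 'I_(k + 1) -> M, dual_in X Y x' y'.
Proof.
move=> [Xx Yy yx] Xv; set v' := v - _ => v'0.
have Xv' : v' \inL X by apply: Lag_sub_comb.
have yv' : gram y v' = 0 by rewrite !gramE yx mul1mx addrN.
have [w Yw wv0] : exists2 w : 'I_1 -> M, w \inL Y & gram w v' != 0.
  apply: contrapT => nw; case/eqP: v'0; apply: (opposite_eq0 XY Xv').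
  apply: Lag_max => m u Yu; apply/matrixP => i j; rewrite !mxE ord1.
  apply/eqP/negPn/negP => huv; apply: nw.
  exists (fun=> u i) => [?|]; first exact: Yu.
  by apply: contra huv => /eqP/matrixP/(_ 0 0)/eqP; rewrite !mxE.
pose w' := w - comb y (jtr J (gram w x)).
have Yw' : w' \inL Y by apply: Lag_sub_comb.
have w'x : gram w' x = 0 by rewrite !gramE yx jtrK mulmx1 addrN.
have w'v : gram w' v' = gram w v'.
  by rewrite (gramDl delta_sign hF) (gramNl delta_sign hF)
     (gram_combl delta_sign hF) yv' mulmx0 subr0.
pose c := gram w v' 0 0.
have cE : gram w v' = c%:M by rewrite [LHS]mx11_scalar.
have cU : c \is a GRing.unit.
  by apply: divD; apply: contra wv0; rewrite cE => /eqP ->; rewrite raddf0.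
exists (join x v'), (join y (comb w' (jtr J (c^-1)%:M))).
split; [exact: all_in_join| |].
  by apply: all_in_join => //; apply: Lag_comb.
rewrite gram_join yx yv' !(gram_combl delta_sign hF) w'x w'v jtrK mulmx0 cE.
by rewrite -scalar_mxM mulVr // -scalar_mx_block.
Qed.

Lemma dual_spanning : exists x y : 'I_n -> M,
  [/\ dual_in X Y x y,
      forall m (v : 'I_m -> M), v \inL X -> v = comb x (gram y v),
      forall m (w : 'I_m -> M), w \inL Y -> w = comb y (jtr J (gram w x))
    & spanning x y].
Proof.
pose P k := `[< exists x y : 'I_k -> M, dual_in X Y x y >].
have P0 : exists k, P k.
  exists 0%N; apply/asboolP; exists (fun=> 0), (fun=> 0).
  by split; [case=> ?|case=> ?|rewrite flatmx0 [RHS]flatmx0].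
have Pb k : P k -> (k <= n)%N.
  by move=> /asboolP[x [y xy]]; apply: (hyp_pair_leq (dual_in_hyp xy) s0).
case: (ex_maxnP P0 Pb) => k /asboolP[x [y xy]] kmax.
have [Xx Yy yx] := xy.
have spX m (v : 'I_m -> M) : v \inL X -> v = comb x (gram y v).
  move=> Xv; apply/funext => i; pose v1 : 'I_1 -> M := fun=> v i.
  suff /eqP : v1 - comb x (gram y v1) == 0.
    move=> /subr0_eq/(congr1 (@^~ 0)); rewrite /v1 => ->.
    by apply: eq_bigr => j _; rewrite !mxE.
  apply/negPn/negP => /(dual_in_extend xy).
  case=> [?|x' [y' xy']]; first exact: Xv.
  have : (k + 1 <= k)%N by apply: kmax; apply/asboolP; exists x', y'.
  by rewrite addn1 ltnn.
have perpX m (w : 'I_m -> M) : gram w x = 0 -> w \inL X.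
  move=> wx; apply: Lag_max => l u Xu.
  by rewrite (gramC delta_sign hF) (spX _ _ Xu) (gram_combr hF) wx mul0mx jtr0 mul0mx.
have spY m (w : 'I_m -> M) : w \inL Y -> w = comb y (jtr J (gram w x)).
  move=> Yw; apply/eqP; rewrite -subr_eq0; apply/eqP.
  apply: (opposite_eq0 XY); last exact: Lag_sub_comb.
  by apply: perpX; rewrite !gramE yx jtrK mulmx1 addrN.
(* What is left of w after removing its components lies in both perps. *)
have sp : spanning x y.
  move=> m w; exists (gram y w), (jtr J (gram w x)).
  apply/eqP; rewrite -subr_eq0; apply/eqP; set w' := _ - _.
  have yw' : gram y w' = 0.
    rewrite (gramDr hF) (gramNr hF) (gramDr hF) !(gram_combr hF) yx.
    by rewrite (Lag_gram Yy Yy) mul0mx addr0 mul1mx addrN.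
  have w'x : gram w' x = 0.
    rewrite (gramDl delta_sign hF) (gramNl delta_sign hF) (gramDl delta_sign hF).
    rewrite !(gram_combl delta_sign hF) yx (Lag_gram Xx Xx).
    by rewrite mulmx0 add0r jtrK mulmx1 addrN.
  apply: (opposite_eq0 XY); first exact: perpX.
  by apply: Lag_max => l u Yu; rewrite (spY _ _ Yu) (gram_combl delta_sign hF) yw' mulmx0.
have kn : k = n.
  apply/anti_leq; rewrite (hyp_pair_leq h0 sp) andbT.
  exact: (hyp_pair_leq (dual_in_hyp xy) s0).
by case: _ / kn x y xy Xx Yy yx spX perpX spY sp => x y *; exists x, y.
Qed.

End DualBases.

(** * Hyperbolic modules *)

Section HyperbolicModule.
Import VectorInternalTheory.
Variables (D : nzRingType) (J : involution D) (delta : D).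
Hypothesis delta_sign : delta = 1 \/ delta = -1.

Lemma hyp_form_hermitian (X : lmodType D^c) :
  hermitian_form J (@hyp_form D J delta X) delta.
Proof.
split=> [u v w|u v a|u v]; rewrite /hyp_form.
- by rewrite jdualD /= jdual_addE inv_add mulrDl addrACA.
- rewrite jdualZ jdual_scaleE inv_mul inv_invol mulrDl; congr (_ + _).
  by rewrite -!mulrA (sign_comm delta_sign).
rewrite inv_add inv_mul inv_invol (inv_sign J delta_sign) mulrDl addrC; congr (_ + _).
by rewrite -(sign_comm delta_sign) -mulrA (sign_sq delta_sign) mulr1.
Qed.

Variables (n : nat) (M : lmodType D^c) (h : M -> M -> D).
Hypothesis hyp : is_hyperbolic J delta n h.

Lemma hyperbolic_hermitian : hermitian_form J h delta.
Proof.
have [X [_ [phi _ hE]]] := hyp; have [hD hZ hC] := hyp_form_hermitian X.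
split=> [u v w|u v a|u v]; rewrite !hE.
- by rewrite raddfD hD.
- by rewrite /rscale linearZ; apply: hZ.
- exact: hC.
Qed.

(** A basis of the underlying module together with its dual basis. *)
Lemma hyperbolic_frame : exists x y : 'I_n -> M, hyp_pair h x y /\ spanning x y.
Proof.
have [X [dX [phi [psi psiK phiK] hE]]] := hyp.
case: _ / dX.
pose e (i : 'I_(dim X)) : X := r2v (delta_mx 0 i).
pose f0 (i : 'I_(dim X)) (v : X) : D := v2r v 0 i.
have f0_lin i : f0 i \in rlinear (X := X).
  apply/asboolP; split=> [u v|u a]; first by rewrite /f0 raddfD mxE.
  by rewrite /f0 /rscale linearZ mxE.
pose f i : jdual X J := SigSub (f0_lin i).
have fE i v : f i v = f0 i v by [].
have fe i j : f i (e j) = (i == j)%:R.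
  by rewrite fE /f0 /e r2vK mxE eqxx.
have eE v : v = \sum_i e i *:> f i v.
  apply: v2r_inj; rewrite raddf_sum [LHS]row_sum_delta.
  apply: eq_bigr => i _.
  by rewrite [RHS](linearZ_LR v2r) /= r2vK.
have f_sum (xi : jdual X J) : xi = \sum_i f i *:> J (xi (e i)).
  apply/val_inj/funext => v.
  rewrite -[LHS]/(jdual_fun xi v) -[RHS]/(jdual_fun _ v) {1}[v]eE jdual_sum.
  rewrite (big_morph (fun eta => jdual_fun eta v) (fun _ _ => erefl) erefl).
  by apply: eq_bigr => i _; rewrite jdualZ jdual_scaleE inv_invol.
pose x i := psi (e i, 0); pose y i := psi (0, f i).
have hx i v : h (x i) v = J (jdual_fun (phi v).2 (e i)) * delta.
  by rewrite hE phiK /hyp_form /= jdual_zeroE add0r.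
have hy i v : h (y i) v = f i (phi v).1.
  by rewrite hE phiK /hyp_form /= jdual0 Defs.inv0 mul0r addr0.
exists x, y; split.
  split; apply/matrixP => i j; rewrite !mxE.
  - by rewrite hx phiK jdual_zeroE Defs.inv0 mul0r.
  - by rewrite hy phiK jdual0.
  - by rewrite hy phiK fe.
move=> m w; exists (\matrix_(i, j) f i (phi (w j)).1).
exists (\matrix_(i, j) J (jdual_fun (phi (w j)).2 (e i))).
have phiZ u a : phi (u *:> a) = ((phi u).1 *:> a, (phi u).2 *:> a).
  by rewrite /rscale linearZ_LR.
apply/funext => j; apply: (can_inj psiK); rewrite fctE raddfD !raddf_sum /=.
under eq_bigr => i _ do rewrite phiZ /= phiK mxE.
under [X in _ + X]eq_bigr => i _ do rewrite phiZ /= phiK mxE.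
rewrite [LHS]surjective_pairing; set v := (phi _).1; set xi := (phi _).2.
have pairE (F : 'I_(dim X) -> (X * jdual X J)%type) :
    \sum_i F i = (\sum_i (F i).1, \sum_i (F i).2).
  by elim/big_rec3: _ => [//|i a b c _ ->]; rewrite [F i]surjective_pairing.
rewrite !pairE /= -eE -f_sum.
rewrite [\sum_i 0 *:> _]big1 => [|i _]; last exact: scaler0.
rewrite [\sum_i 0 *:> _]big1 => [|i _]; last exact: scaler0.
by apply/pair_equal_spec; split; rewrite /= ?addr0 ?add0r.
Qed.

End HyperbolicModule.

(** * Matrices adapted to three Lagrangians *)

Section Adapted.
Variables (D : nzRingType) (J : involution D) (eps : D) (M : lmodType D^c).
Variables (h : M -> M -> D).
Hypothesis eps_sign : eps = 1 \/ eps = -1.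
Hypothesis hF : hermitian_form J h (- eps).
Implicit Types X Y Z U : Lagrangian h.
Notation "u \inL X" := (all_in (val X) u) (at level 70).
Notation gram := (gram h).
Local Notation delta := (- eps).
Let ds := opp_sign eps_sign.
Local Notation gramE := (gramE ds hF).

Lemma basis_of_dual (V : set M) n (e f : 'I_n -> M) :
  all_in V e -> (forall w : 'I_1 -> M, all_in V w -> exists a, w = comb e a) ->
  gram f e = 1%:M -> is_basis V e.
Proof.
move=> Ve sp fe; split=> // v Vv.
have [|a aE] := sp (fun=> v); first by [].
exists (fun i => a i 0); split=> [|c cE].
  by rewrite -[LHS]/((fun _ : 'I_1 => v) 0) aE.
suff -> : a = \matrix_(i, _) c i by apply/funext => i; rewrite mxE.
apply: (gram_dual_inj hF fe); rewrite -aE; apply/funext => k.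
by rewrite cE /comb; apply: eq_bigr => i _; rewrite mxE.
Qed.

Lemma Lag_basis_comb X n (e f : 'I_n -> M) (b b' : 'M[D]_n) :
  is_basis (val X) e -> gram f e = 1%:M -> is_inverse b b' ->
  is_basis (val X) (comb e b).
Proof.
move=> eB fe [bb' b'b]; have [Xe _] := eB.
apply: (@basis_of_dual _ _ _ (comb f (jtr J b'))); first exact: Lag_comb.
  move=> w Xw; have [a ->] := basis_span eB Xw; exists (b' *m a).
  by rewrite combA mulmxA bb' mul1mx.
by rewrite !gramE jtrK fe mulmx1.
Qed.

Lemma basis_perp X n m (x : 'I_n -> M) (w : 'I_m -> M) :
  is_basis (val X) x -> gram x w = 0 -> w \inL X.
Proof.
move=> xB xw; apply: Lag_max => k u Xu; have [a ->] := basis_span xB Xu.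
by rewrite !gramE xw mulmx0.
Qed.

Definition adapted n X Y Z (x y : 'I_n -> M) (t : 'M[D]_n) :=
  [/\ is_basis (val X) x, is_basis (val Y) y, gram y x = 1%:M
    & is_basis (val Z) (y + comb x t)].

Lemma kappaP n X Y Z (t : 'M[D]_n) :
  kappa X Y Z t <-> exists x y, adapted X Y Z x y t.
Proof.
split=> -[x [y [xB yB yx zB]]]; exists x, y; split=> //.
  by apply/matrixP => i j; rewrite !mxE yx.
by move=> i j; have /matrixP/(_ i j) := yx; rewrite !mxE.
Qed.

Section DualFamilies.
Variables (n : nat) (X Y : Lagrangian h) (x y : 'I_n -> M).
Hypotheses (Xx : x \inL X) (Yy : y \inL Y) (yx : gram y x = 1%:M).

Lemma gram_dualC : gram x y = delta%:M.
Proof. by rewrite (gramC ds hF) yx jtr1 mul1mx. Qed.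

(** As [h] is [- eps]-hermitian, the dual basis of [y] in [X] is [x] scaled by
    [- eps], and not [x]. *)
Lemma gram_swap : gram (comb x delta%:M) y = 1%:M.
Proof. by rewrite !gramE (jtr_sign J ds) gram_dualC (mx_sign_sq ds). Qed.

Lemma gram_swap_shear t : gram (comb x delta%:M) (y + comb x t) = 1%:M.
Proof.
rewrite (gramDr hF) (gram_combr hF) gram_swap (@Lag_gram _ _ _ X) ?mul0mx ?addr0 //.
exact: Lag_comb.
Qed.

Lemma gram_y_shear t : gram y (y + comb x t) = t.
Proof. by rewrite !gramE (Lag_gram Yy Yy) yx add0r mul1mx. Qed.

Lemma gram_shear_x t : gram (y + comb x t) x = 1%:M.
Proof. by rewrite !gramE (Lag_gram Xx Xx) yx mulmx0 addr0. Qed.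

End DualFamilies.

Lemma adapted_hermitian n X Y Z (x y : 'I_n -> M) t :
  adapted X Y Z x y t -> is_hermitian J eps t.
Proof.
move=> [[Xx _] [Yy _] yx [Zz _]].
have := Lag_gram Zz Zz; rewrite (gramDl ds hF) (gram_y_shear Yy yx) !gramE.
rewrite (Lag_gram Xx Xx) (gram_dualC yx) mulmx0 mul0mx addr0.
by rewrite raddfN mulmxN => /eqP; rewrite subr_eq0 => /eqP.
Qed.

Lemma adapted_sub n X Y Z U (x y : 'I_n -> M) a b :
  adapted X Y Z x y a -> adapted X Y U x y b ->
  adapted X Z U x (y + comb x a) (b - a).
Proof.
move=> [xB yB yx zB] [_ _ _ uB]; split=> //.
  by case: xB => Xx _; apply: (gram_shear_x Xx).
by rewrite -addrA -combDr [a + _]addrC subrK.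
Qed.

(** The case [U = Y], [b = 0] of [adapted_sub]. *)
Lemma adapted_swap23 n X Y Z (x y : 'I_n -> M) a :
  adapted X Y Z x y a -> adapted X Z Y x (y + comb x a) (- a).
Proof.
move=> A; rewrite -sub0r; apply: (adapted_sub A).
by case: A => xB yB yx _; split=> //; rewrite comb0 addr0.
Qed.

(** The new basis of [Z] is the old one multiplied by [- t^-J]; since [t] is
    [eps]-hermitian, [t (- t^-J) = - eps], which is the required coefficient
    at [x]. *)
Lemma adapted_swap12 n X Y Z (x y : 'I_n -> M) t b :
  adapted X Y Z x y t -> is_inverse t b ->
  adapted Y X Z y (comb x delta%:M) (- jtr J b).
Proof.
move=> A tb; have ht := adapted_hermitian A.
have [xB yB yx zB] := A; have [Xx _] := xB.
have dI : is_inverse (delta%:M : 'M[D]_n) delta%:M by split; rewrite (mx_sign_sq ds).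
have sE : - jtr J b = b *m delta%:M.
  by rewrite (hermitian_jtr eps_sign (hermitian_inv eps_sign tb ht)) raddfN mulmxN.
split=> //.
- exact: (Lag_basis_comb xB yx dI).
- exact: gram_swap.
have -> : comb x delta%:M + comb y (- jtr J b) = comb (y + comb x t) (- jtr J b).
  by rewrite combDl combA sE mulmxA tb.1 mul1mx addrC.
apply: (Lag_basis_comb zB (gram_swap_shear Xx yx t)).
exact: (is_inverse_opp (is_inverse_jtr J (is_inverse_sym tb))).
Qed.

Lemma adapted_congruent n X Y Z (x y : 'I_n -> M) t b b' :
  adapted X Y Z x y t -> is_inverse b b' ->
  adapted X Y Z (comb x (jtr J b')) (comb y b) (jtr J b *m t *m b).
Proof.
move=> [xB yB yx zB] bb'; have [Xx _] := xB.
split.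
- exact: (Lag_basis_comb xB yx (is_inverse_jtr J (is_inverse_sym bb'))).
- exact: (Lag_basis_comb yB (gram_swap yx) bb').
- by rewrite !gramE yx mulmx1 -jtr_mul bb'.2 jtr1.
rewrite combA !mulmxA -jtr_mul bb'.1 jtr1 mul1mx -combA -combDl.
exact: (Lag_basis_comb zB (gram_swap_shear Xx yx t) bb').
Qed.

(** If [P] and [Q] are the base changes in [X] and [Y], then [Q^J P = 1] because
    both pairs of bases are dual, and the basis of [Z] changes by [Q] too, by
    comparison of coefficients at [y]; those at [x] give [P t' = t Q]. *)
Lemma adapted_unique n X Y Z (x y x' y' : 'I_n -> M) t t' :
  adapted X Y Z x y t -> adapted X Y Z x' y' t' -> isoclass J t t'.
Proof.
move=> [xB yB yx zB] [xB' yB' yx' zB'].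
have [Xx _] := xB; have [Yy _] := yB.
have [Xx' _] := xB'; have [Yy' _] := yB'; have [Zz' _] := zB'.
have [P xP] := basis_span xB Xx'; have [P' xP'] := basis_span xB' Xx.
have [Q yQ] := basis_span yB Yy'; have [c zc] := basis_span zB Zz'.
have PP' : P *m P' = 1%:M.
  by rewrite -yx [x in RHS]xP' xP !gramE yx mul1mx.
have P'P : P' *m P = 1%:M.
  by rewrite -yx' [x' in RHS]xP [x in RHS]xP' !gramE yx' mul1mx.
have QP' : jtr J Q = P'.
  by rewrite -[P']mul1mx -yx' yQ xP !gramE yx mulmx1 -mulmxA PP' mulmx1.
have cQ : c = Q.
  have := congr1 (gram (comb x delta%:M)) zc.
  rewrite (gram_combr hF) (gram_swap_shear Xx yx) mul1mx => <-.
  rewrite yQ (gramDr hF) !(gram_combr hF) (gram_swap yx) mul1mx.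
  by rewrite (@Lag_gram _ _ _ X) ?mul0mx ?addr0 //; apply: Lag_comb.
have Pt : P *m t' = t *m Q.
  have := congr1 (gram y) zc.
  rewrite (gram_combr hF) (gram_y_shear Yy yx) cQ => <-.
  by rewrite (gramDr hF) (Lag_gram Yy Yy') add0r xP !(gram_combr hF) yx mul1mx.
apply/isoclassP; exists Q; last by rewrite QP' -mulmxA -Pt mulmxA P'P mul1mx.
exists (jtr J P); rewrite -[Q](jtrK J) QP'.
by apply: is_inverse_jtr; split.
Qed.

Lemma kappa_isoclass n X Y Z (x y : 'I_n -> M) t :
  adapted X Y Z x y t -> kappa X Y Z = isoclass J t.
Proof.
move=> A; apply/seteqP; split=> s.
  by move=> /kappaP[x' [y' A']]; apply: (adapted_unique A A').
move=> /isoclassP[b [b' bb'] ->]; apply/kappaP.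
by exists (comb x (jtr J b')), (comb y b); apply: adapted_congruent.
Qed.

Lemma isometry_comb (g : Defs.isometry h) m n (u : 'I_m -> M) (a : 'M[D]_(m, n)) :
  g \o comb u a = comb (g \o u) a.
Proof.
apply/funext => j; rewrite /= raddf_sum; apply: eq_bigr => i _.
exact: linearZ_LR.
Qed.

Lemma isometry_basis (g : Defs.isometry h) (V : set M) n (e : 'I_n -> M) :
  is_basis V e -> is_basis (g @` V)%classic (g \o e).
Proof.
have [k gK _] := isometry_bij g.
have gsum (c : 'I_n -> D) : g (\sum_i e i *:> c i) = \sum_i (g \o e) i *:> c i.
  by rewrite raddf_sum; apply: eq_bigr => i _; apply: linearZ_LR.
move=> [Ve eB]; split=> [i|_ [v Vv <-]]; first by exists (e i).
have [c [cE cU]] := eB v Vv; exists c.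
split=> [|c']; rewrite -gsum; first by rewrite -cE.
by move=> /(can_inj gK); apply: cU.
Qed.

Lemma adapted_isometry (g : Defs.isometry h) n X Y Z (x y : 'I_n -> M) t :
  adapted X Y Z x y t ->
  adapted (isometry_act g X) (isometry_act g Y) (isometry_act g Z)
          (g \o x) (g \o y) t.
Proof.
move=> [xB yB yx zB]; split; try exact: isometry_basis.
  by rewrite -yx; apply/matrixP => i j; rewrite !mxE isometry_form.
have -> : g \o y + comb (g \o x) t = g \o (y + comb x t).
  by rewrite -isometry_comb; apply/funext => i; rewrite /= !fctE /= raddfD.
exact: isometry_basis.
Qed.

End Adapted.

(** * The Witt class of a triple of Lagrangians *)

Section Maslov.
Variables (D : nzRingType) (J : involution D) (eps : D) (M : lmodType D^c).
Variables (h : M -> M -> D) (n : nat).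
Hypothesis eps_sign : eps = 1 \/ eps = -1.
Hypothesis hF : hermitian_form J h (- eps).
Implicit Types X Y Z : Lagrangian h.
Notation W t := (Witt_class (Herm_class t)).

(** The value is 0 when no nonsingular hermitian matrix belongs to the triple,
    so that this is a function of all triples, opposite or not. *)
Definition maslov X Y Z : Witt J eps :=
  xget 0 [set w | exists2 t : nsherm J eps n,
                    kappa X Y Z (nsherm_mx t) & w = W t].

Lemma maslovE X Y Z (t : nsherm J eps n) :
  kappa X Y Z (nsherm_mx t) -> maslov X Y Z = W t.
Proof.
move=> Kt; rewrite /maslov.
case: xgetP => [w _ [s Ks ->]|/(_ (W t)) []]; last by exists t.
have [x [y A]] := (kappaP X Y Z t).1 Kt; have [x' [y' A']] := (kappaP X Y Z s).1 Ks.
exact/esym/Witt_isoclass/(adapted_unique eps_sign hF A A').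
Qed.

Lemma maslov0 X Y Z :
  ~ (exists t : nsherm J eps n, kappa X Y Z (nsherm_mx t)) -> maslov X Y Z = 0.
Proof. by move=> nK; apply: xgetPN => w [t Kt _]; apply: nK; exists t. Qed.

Lemma maslov_transport X Y Z X' Y' Z' :
  (forall t : nsherm J eps n, kappa X Y Z (nsherm_mx t) ->
     exists2 s : nsherm J eps n, kappa X' Y' Z' (nsherm_mx s) & W s = - W t) ->
  (forall t : nsherm J eps n, kappa X' Y' Z' (nsherm_mx t) ->
     exists2 s : nsherm J eps n, kappa X Y Z (nsherm_mx s) & W s = - W t) ->
  maslov X' Y' Z' = - maslov X Y Z.
Proof.
move=> K K'.
have [[t Kt]|nK] := pselect (exists t : nsherm J eps n, kappa X Y Z (nsherm_mx t)).
  by have [s Ks sE] := K t Kt; rewrite (maslovE Kt) (maslovE Ks).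
rewrite (maslov0 nK) oppr0 maslov0 // => -[t /K'[s Ks _]].
by apply: nK; exists s.
Qed.

Lemma maslov_swap12 X Y Z : maslov Y X Z = - maslov X Y Z.
Proof.
suff K X' Y' Z' (t : nsherm J eps n) : kappa X' Y' Z' (nsherm_mx t) ->
    exists2 s : nsherm J eps n, kappa Y' X' Z' (nsherm_mx s) & W s = - W t.
  by apply: maslov_transport => t; apply: K.
move=> /kappaP[x [y A]]; have [b tb] := nsherm_nonsingular t.
have sI := is_inverse_sym (is_inverse_opp (is_inverse_jtr J tb)).
have hb := hermitian_inv eps_sign tb (nsherm_hermitian t).
pose s := NsHerm (ex_intro _ _ sI) (hermitian_opp (jtr_hermitian eps_sign hb)).
exists s.
  apply/kappaP; exists y, (comb x (- eps)%:M).
  exact: (adapted_swap12 eps_sign hF A tb).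
rewrite -Witt_opp //; symmetry; apply: (@Witt_congruent _ _ _ _ _ _ b).
  by exists t; apply: is_inverse_sym.
by rewrite /= mulmxN mulNmx -mulmxA tb.1 mulmx1.
Qed.

Lemma maslov_swap23 X Y Z : maslov X Z Y = - maslov X Y Z.
Proof.
suff K X' Y' Z' (t : nsherm J eps n) : kappa X' Y' Z' (nsherm_mx t) ->
    exists2 s : nsherm J eps n, kappa X' Z' Y' (nsherm_mx s) & W s = - W t.
  by apply: maslov_transport => t; apply: K.
move=> /kappaP[x [y A]]; exists (opp_herm t); last exact: Witt_opp.
apply/kappaP; exists x, (y + comb x t).
exact: (adapted_swap23 eps_sign hF A).
Qed.

Lemma Witt_trivial (t : nsherm J eps n) : 1%:M = 0 :> 'M[D]_n -> W t = 0.
Proof.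
case: n t => [t _|k t /matrixP/(_ 0 0)/eqP]; first exact: Witt_dim0.
by rewrite !mxE eqxx oner_eq0.
Qed.

(** A nonsingular matrix belongs to a triple with a repetition only in rank 0,
    where the zero module is a Lagrangian opposite to itself. *)
Lemma maslov_degenerate X Y Z : [\/ X = Y, X = Z | Y = Z] -> maslov X Y Z = 0.
Proof.
move=> XYZ; have [[t Kt]|/maslov0 //] :=
  pselect (exists t : nsherm J eps n, kappa X Y Z (nsherm_mx t)).
rewrite (maslovE Kt); apply: Witt_trivial.
have /kappaP[x [y [[Xx _] [Yy _] yx [Zz _]]]] := Kt.
case: XYZ => e.
- by rewrite -yx; apply: (@Lag_gram _ _ _ Y) => //; rewrite -e.
- rewrite -(gram_shear_x eps_sign hF Xx yx t); apply: (@Lag_gram _ _ _ Z) => //.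
  by rewrite -e.
have [b [tb _]] := nsherm_nonsingular t.
rewrite -tb -[nsherm_mx t](gram_y_shear hF Yy yx).
by rewrite (@Lag_gram _ _ _ Z) ?mul0mx // -e.
Qed.

End Maslov.

(** * Opposite Lagrangians and the cocycle identity *)

Section OppositeTriples.
Variables (D : unitRingType) (divD : GRing.field_axiom D).
Variables (J : involution D) (eps : D) (n : nat).
Hypothesis eps_sign : eps = 1 \/ eps = -1.
Variables (M : lmodType D^c) (h : M -> M -> D).
Hypothesis hyp : is_hyperbolic J (- eps) n h.
Implicit Types X Y Z U : Lagrangian h.
Notation "u \inL X" := (all_in (val X) u) (at level 70).
Notation gram := (gram h).
Notation W t := (Witt_class (Herm_class t)).
Local Notation delta := (- eps).
Let ds := opp_sign eps_sign.
Let hF : hermitian_form J h delta := hyperbolic_hermitian ds hyp.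

Lemma opposite_decomp X Y m (w : 'I_m -> M) : opposite X Y ->
  exists u v, [/\ u \inL X, v \inL Y & w = u + v].
Proof.
have [x0 [y0 [h0 s0]]] := hyperbolic_frame hyp.
move=> /(dual_spanning divD ds hF h0 s0)[x [y [[Xx Yy _] _ _ sp]]].
have [a [b ->]] := sp _ w.
by exists (comb x a), (comb y b); split=> //; apply: Lag_comb.
Qed.

Lemma opposite_bases X Y : opposite X Y ->
  exists x y : 'I_n -> M,
    [/\ is_basis (val X) x, is_basis (val Y) y & gram y x = 1%:M].
Proof.
have [x0 [y0 [h0 s0]]] := hyperbolic_frame hyp.
move=> /(dual_spanning divD ds hF h0 s0)[x [y [[Xx Yy yx] spX spY _]]].
exists x, y; split=> //.
  by apply: (basis_of_dual hF Xx _ yx) => w Xw; exists (gram y w); apply: spX.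
apply: (basis_of_dual hF Yy _ (gram_swap eps_sign hF yx)) => w Yw.
by exists (jtr J (gram w x)); apply: spY.
Qed.

(** The components [z] of [y] in the summand [Z] of [X + Z] are still dual to
    [x]; they differ from [y] by vectors of [X], that is, by some [x t]. *)
Lemma adapted_exists X Y Z (x y : 'I_n -> M) :
  is_basis (val X) x -> is_basis (val Y) y -> gram y x = 1%:M -> opposite X Z ->
  exists t, adapted X Y Z x y t.
Proof.
move=> xB yB yx XZ; have [Xx _] := xB.
have [u [z [Xu Zz yE]]] := opposite_decomp y XZ.
have [a uE] := basis_span xB Xu.
have zE : y + comb x (- a) = z by rewrite combN -uE yE addrC addKr.
exists (- a); split=> //; rewrite zE.
have dz : gram (comb x delta%:M) z = 1%:M.
  by rewrite -zE (gram_swap_shear eps_sign hF Xx).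
have xz : gram x z = delta%:M.
  rewrite -[RHS]mulmx1 -dz (gram_combl ds hF) (jtr_sign J ds) mulmxA.
  by rewrite (mx_sign_sq ds) mul1mx.
apply: (basis_of_dual hF Zz _ dz) => w Zw; exists (gram (comb x delta%:M) w).
apply/eqP; rewrite -subr_eq0; apply/eqP.
apply: (opposite_eq0 XZ); last exact: Lag_sub_comb.
apply: (basis_perp eps_sign hF xB).
by rewrite !(gramE ds hF) xz (jtr_sign J ds) mulmxA (mx_sign_sq ds) mul1mx addrN.
Qed.

(** Let [c] be the coordinates, in the basis [y + x t] of [Z], of the components
    of [x] in the summand [Z] of [Y + Z].  Comparing coefficients at [x] gives
    [t c = 1]; as [t] is hermitian, it has a left inverse too. *)
Lemma adapted_nonsingular X Y Z (x y : 'I_n -> M) t :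
  adapted X Y Z x y t -> opposite Y Z -> nonsingular t.
Proof.
move=> A YZ; have ht := adapted_hermitian eps_sign hF A.
have [_ yB yx zB] := A; have [Yy _] := yB.
have [v [w [Yv Zw xE]]] := opposite_decomp x YZ.
have [c wE] := basis_span zB Zw.
have tc : t *m c = 1%:M.
  rewrite -yx xE (gramDr hF) (Lag_gram Yy Yv) add0r wE (gram_combr hF).
  by rewrite (gram_y_shear hF Yy yx).
have dt : (eps%:M *m jtr J c) *m t = 1%:M.
  rewrite -(mx_sign_comm eps_sign (jtr J c)) -mulmxA -(mx_sign_comm eps_sign t).
  by rewrite -(hermitian_jtr eps_sign ht) -jtr_mul tc jtr1.
exists c; split=> //.
by rewrite -[c in LHS]mul1mx -dt -[_ *m t *m c]mulmxA tc mulmx1 dt.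
Qed.

Lemma adapted_maslov X Y Z (x y : 'I_n -> M) t :
  adapted X Y Z x y t -> opposite Y Z ->
  exists2 s : nsherm J eps n, nsherm_mx s = t & maslov J eps n X Y Z = W s.
Proof.
move=> A YZ.
exists (NsHerm (adapted_nonsingular A YZ) (adapted_hermitian eps_sign hF A)) => //.
by apply: (maslovE eps_sign hF); apply/kappaP; exists x, y.
Qed.

(** With [a] and [b] adapted to [(X, Y, Z)] and [(X, Y, U)] for the same bases,
    the identity is [Witt_add] for [b], [- a] and [a - b]. *)
Lemma maslov_cocycle X Y Z U :
  opposite X Y -> opposite X Z -> opposite X U ->
  opposite Y Z -> opposite Y U -> opposite Z U ->
  maslov J eps n Y Z U - maslov J eps n X Z U
  + maslov J eps n X Y U - maslov J eps n X Y Z = 0.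
Proof.
move=> XY XZ XU YZ YU ZU.
have [x [y [xB yB yx]]] := opposite_bases XY.
have [a A] := adapted_exists xB yB yx XZ; have [b B] := adapted_exists xB yB yx XU.
have [ta taE ->] := adapted_maslov A YZ; have [tb tbE ->] := adapted_maslov B YU.
have [td tdE ->] := adapted_maslov (adapted_sub eps_sign hF A B) ZU.
have [a' aa'] : nonsingular a by rewrite -taE; apply: nsherm_nonsingular.
have [b' bb'] : nonsingular b by rewrite -tbE; apply: nsherm_nonsingular.
have A' := adapted_swap12 eps_sign hF A aa'.
have B' := adapted_swap12 eps_sign hF B bb'.
have [te teE ->] := adapted_maslov (adapted_sub eps_sign hF A' B') ZU.
have [|u uE] := Witt_add eps_sign (r := tb) (s := opp_herm ta) (t := opp_herm td).
  by rewrite /= taE tbE tdE addrN.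
have -> : W u = W te.
  apply: Witt_mx_eq; rewrite uE teE /= taE tbE jtrN.
  rewrite (minv_eq (is_inverse_jtr J bb')).
  by rewrite (minv_eq (is_inverse_opp (is_inverse_jtr J aa'))).
rewrite !Witt_opp // => e; rewrite -[RHS]e.
rewrite [RHS]addrC addrA [RHS]addrAC addrA -!addrA.
by do !congr (_ + _); rewrite addrC.
Qed.

End OppositeTriples.

(** * Cochains on the alternating chain complex *)

Section QuotientLift.
Variables (V A : zmodType) (S : set V) (f : {additive V -> A}).

Definition quot_lift of (forall v, S v -> f v = 0) : quot_gen S -> A :=
  fun c => f (quot_repr c).

Hypothesis fS : forall v, S v -> f v = 0.

Lemma quot_lift_class v : quot_lift fS (quot_class S v) = f v.
Proof.
apply/eqP; rewrite -subr_eq0 -raddfB; pose P : {pred V} := fun v => f v == 0.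
apply: (@subgroup_gen_min _ S P); last by rewrite quot_classP quot_reprK.
  split=> [|a b /eqP ea /eqP eb]; first by rewrite /in_mem /= /P raddf0.
  by rewrite /in_mem /= /P raddfB ea eb subr0.
by move=> w /fS e; apply/eqP.
Qed.

Lemma quot_lift_is_zmod_morphism : zmod_morphism (quot_lift fS).
Proof.
move=> c d; rewrite -[c]quot_reprK -[d]quot_reprK -raddfB !quot_lift_class.
exact: raddfB.
Qed.

HB.instance Definition _ :=
  GRing.isZmodMorphism.Build (quot_gen S) A (quot_lift fS) quot_lift_is_zmod_morphism.

End QuotientLift.

Lemma freeg_additive_eq0 (K : choiceType) (A : zmodType)
    (f : {additive {freeg K} -> A}) :
  (forall x, f << x >> = 0) -> forall c, f c = 0.
Proof.
move=> f0 c; rewrite -[c]freeg_sumE raddf_sum big1 // => x _.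
have -> : << coeff x c *g x >> = << x >> *~ coeff x c :> {freeg K}.
  by rewrite freegU_mulz intz.
by rewrite raddfMz f0 mul0rz.
Qed.

Lemma ord3P (i : 'I_3) : [\/ i = 0, i = 1 | i = 2].
Proof.
by case: i => [[|[|[|//]]] ?]; [constructor 1|constructor 2|constructor 3];
   apply/val_inj.
Qed.

Section AlternatingFunctions.
Variables (V : choiceType) (adj : rel V) (A : zmodType) (f : V -> V -> V -> A).
Hypothesis f12 : forall u v w, f v u w = - f u v w.
Hypothesis f23 : forall u v w, f u w v = - f u v w.
Hypothesis f_eq : forall u v w, [\/ u = v, u = w | v = w] -> f u v w = 0.

Definition on_simplex (x : Fl adj 2) : A :=
  f (vertex x 0) (vertex x 1) (vertex x 2).

Lemma vertex_reindex k l (g : 'I_l.+1 -> 'I_k.+1) (x : Fl adj k) i :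
  vertex (Defs.reindex g x) i = vertex x (g i).
Proof. by rewrite /vertex ffunE. Qed.

Lemma on_simplex_tperm (a b : 'I_3) (x : Fl adj 2) :
  a != b -> on_simplex (Defs.reindex (tperm a b) x) = - on_simplex x.
Proof.
have f13 u v w : f w v u = - f u v w by rewrite f12 f23 f12 opprK.
rewrite /on_simplex !vertex_reindex.
by case: (ord3P a) => ->; case: (ord3P b) => -> //= _; rewrite !permE /=.
Qed.

Lemma on_simplex_perm (s : 'S_3) (x : Fl adj 2) :
  on_simplex (Defs.reindex s x) = on_simplex x *~ (-1) ^+ s.
Proof.
have [ts -> ts_neq] := prod_tpermP s.
elim: ts ts_neq x => [|t ts IH] /= => [_|/andP[t_neq /IH{}IH]] x.
  by rewrite big_nil odd_perm1 mulr1z /on_simplex !vertex_reindex !perm1.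
have reindexM (r q : 'S_3) :
    on_simplex (Defs.reindex (r * q)%g x) = on_simplex (Defs.reindex r (Defs.reindex q x)).
  by rewrite /on_simplex !vertex_reindex !permM.
rewrite big_cons reindexM on_simplex_tperm // IH odd_permM odd_tperm.
by rewrite t_neq signr_addb expr1 mulN1r mulrNz.
Qed.

Definition on_chain (c : chain adj 2) : A :=
  fglift (on_simplex : Fl adj 2 -> zmodule A) c.

Lemma on_chain_is_zmod_morphism : zmod_morphism on_chain.
Proof. exact: (@lift_is_additive int (Fl adj 2) (zmodule A) on_simplex). Qed.

HB.instance Definition _ :=
  GRing.isZmodMorphism.Build (chain adj 2) A on_chain on_chain_is_zmod_morphism.

Lemma on_chainU x : on_chain << x >> = on_simplex x.
Proof. by rewrite /on_chain liftU; apply: mulr1z. Qed.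

Lemma on_chain_alt_rel c : alt_rel c -> on_chain c = 0.
Proof.
case=> [[x [i [j [lt_ij xij]]] ->]|[x [s ->]]].
  rewrite on_chainU; apply: f_eq; move: lt_ij xij.
  case: (ord3P i) => ->; case: (ord3P j) => -> //= _ ->;
  by [constructor 1|constructor 2|constructor 3].
have onZ (m : int) d : on_chain (m *: d) = on_chain d *~ m.
  by rewrite -[m in LHS]intz scaler_int raddfMz.
rewrite raddfB /= onZ !on_chainU on_simplex_perm -mulrzA.
by rewrite -[_ * _]signr_addb addbb mulr1z subrr.
Qed.

Definition alt_cochain : alt_chain adj 2 -> A := quot_lift on_chain_alt_rel.
HB.instance Definition _ := GRing.Additive.on alt_cochain.

Lemma alt_cochainE x : alt_cochain (alt_simplex x) = on_simplex x.
Proof. by rewrite /alt_cochain /alt_simplex /alt_class quot_lift_class /= on_chainU. Qed.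

Lemma simplex_dichotomy k (x : Fl adj k) :
  (exists i j, i != j /\ vertex x i = vertex x j) \/
  (forall i j, i != j -> adj (vertex x i) (vertex x j)).
Proof.
have [|nx] := pselect (exists i j, i != j /\ vertex x i = vertex x j); first by left.
right=> i j ij; have /forallP/(_ i)/forallP/(_ j)/orP[/eqP xij|//] := valP x.
by case: nx; exists i, j.
Qed.

(** Simplices with a repeated vertex vanish in the alternating complex, so only
    pairwise adjacent vertices matter. *)
Lemma alt_cochain_cocycle :
  (forall u v w z, adj u v -> adj u w -> adj u z -> adj v w -> adj v z -> adj w z ->
     f v w z - f u w z + f u v z - f u v w = 0) ->
  is_cocycle alt_cochain.
Proof.
move=> fd c; rewrite -[c]quot_reprK -/(alt_class _) alt_boundary_class.
move: (quot_repr c) => {}c.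
pose F := [the {additive _ -> _} of alt_cochain \o @alt_class _ adj 2 \o @boundary _ adj 2].
apply: (freeg_additive_eq0 (f := F)) => x; rewrite /F /=.
have [[i [j [ij xij]]]|xadj] := simplex_dichotomy x.
  rewrite -alt_boundary_class -/(alt_simplex _) (alt_simplex_degenerate ij xij).
  by rewrite -[0](raddf0 (@alt_class _ adj 3)) alt_boundary_class !raddf0.
rewrite boundaryE raddf_sum /= !big_ord_recl big_ord0 !raddfMz /= !alt_cochainE.
have faceE (i a b d : 'I_4) :
    fintype.lift i (0 : 'I_3) = a :> nat -> fintype.lift i (1 : 'I_3) = b :> nat ->
    fintype.lift i (2 : 'I_3) = d :> nat ->
    on_simplex (face i x) = f (vertex x a) (vertex x b) (vertex x d).
  by move=> /val_inj<- /val_inj<- /val_inj<-; rewrite /on_simplex !vertex_reindex.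
have signE (a : A) m : a *~ (-1) ^+ m = if odd m then - a else a.
  by rewrite -signr_odd; case: (odd m); rewrite ?mulrN1z ?mulr1z.
rewrite (faceE _ 1 2 3) // (faceE _ 0 2 3) // (faceE _ 0 1 3) // (faceE _ 0 1 2) //.
by rewrite !signE /= addr0 !addrA; apply: fd; apply: xadj.
Qed.

End AlternatingFunctions.

(** * The invariant cocycle of the opposition graph *)

Theorem theorem5p3 (D : unitRingType) (divD : GRing.field_axiom D)
    (J : involution D) (eps : D) (heps : eps = 1 \/ eps = -1) (n : nat) :
  (* (i) *)
  (forall r s : nsherm J eps n,
     nsherm_mx r + nsherm_mx s = 0 ->
     Witt_class (Herm_class r) + Witt_class (Herm_class s) = 0) /\
  (* (ii) *)
  (forall r s t : nsherm J eps n,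
     nsherm_mx r + nsherm_mx s + nsherm_mx t = 0 ->
     exists2 u : nsherm J eps n,
       nsherm_mx u = - minv (jtr J r) - minv (jtr J s) &
       Witt_class (Herm_class r) + Witt_class (Herm_class s)
       + Witt_class (Herm_class t) + Witt_class (Herm_class u) = 0) /\
  (* the cocycle *)
  (forall (M : vectType D^c) (h : M -> M -> D),
     is_hyperbolic J (- eps) n h ->
     exists m : {additive opp_chain h 2 -> Witt J eps},
       [/\ forall (X Y Z : Lagrangian h) (XY : opposite X Y)
              (XZ : opposite X Z) (YZ : opposite Y Z),
             exists2 c : Herm J eps n,
               kappa X Y Z = val c & m (opp_triangle XY XZ YZ) = Witt_class c,
           is_invariant m
         & is_cocycle m]).
Proof.
split; first exact: Witt_add_eq0 heps n.
split; first exact: Witt_add heps n.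
move=> M h hyp.
have hF := hyperbolic_hermitian (opp_sign heps) hyp.
pose f : Lagrangian h -> Lagrangian h -> Lagrangian h -> Witt J eps := maslov J eps n.
have f12 : forall X Y Z, f Y X Z = - f X Y Z := maslov_swap12 n heps hF.
have f23 : forall X Y Z, f X Z Y = - f X Y Z := maslov_swap23 n heps hF.
have f_eq : forall X Y Z, [\/ X = Y, X = Z | Y = Z] -> f X Y Z = 0 :=
  maslov_degenerate n heps hF.
have fE X Y Z : opposite X Y -> opposite X Z -> opposite Y Z ->
    exists x y, exists2 t : nsherm J eps n,
      adapted X Y Z x y t & f X Y Z = Witt_class (Herm_class t).
  move=> XY XZ YZ; have [x [y [xB yB yx]]] := opposite_bases divD heps hyp XY.
  have [t A] := adapted_exists divD heps hyp xB yB yx XZ.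
  have [s sE fE] := adapted_maslov divD heps hyp A YZ.
  by exists x, y, s; rewrite ?sE.
pose m : {additive opp_chain h 2 -> Witt J eps} :=
  alt_cochain (adj := @opposite D M h) f12 f23 f_eq.
have mE x : m (alt_simplex x) = f (vertex x 0) (vertex x 1) (vertex x 2).
  exact: alt_cochainE.
exists m; split.
- move=> X Y Z XY XZ YZ; have [x [y [t A tE]]] := fE X Y Z XY XZ YZ.
  exists (Herm_class t); first exact: (kappa_isoclass heps hF A).
  by rewrite mE /vertex !ffunE.
- move=> g x; have [[i [j [ij xij]]]|xadj] := simplex_dichotomy x.
    rewrite (alt_simplex_degenerate ij xij) (alt_simplex_degenerate ij) //.
    by rewrite /vertex !ffunE -!/(vertex _ _) xij.
  have [u [v [t A tE]]] := fE _ _ _ (xadj 0 1 isT) (xadj 0 2 isT) (xadj 1 2 isT).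
  rewrite !mE tE /vertex !ffunE; apply: (maslovE heps hF); apply/kappaP.
  by exists (g \o u), (g \o v); apply: adapted_isometry.
apply: alt_cochain_cocycle; exact: (maslov_cocycle divD heps hyp).
Qed.
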